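(* For every weight $w\in A_2^{\mathcal{D}}$ on $\mathbb{R}$, $$\sup_{b}\frac{\|\Pi_b:L^2(w)\to L^2(w^{-1})\|}{\|b\|_{BMO^{\mathcal{D}}(w)}}\ge\frac16\,\|S_{\mathcal{D}}:L^2(w)\to L^2(w)\|^2,$$ where the supremum is over $b\in BMO^{\mathcal{D}}(w)$ with nonzero norm. Consequently the quadratic dependence on $[w]_{A_2}$ in the bound $\|\Pi_b:L^2(w)\to L^2(w^{-1})\|\lesssim\|b\|_{BMO^{\mathcal{D}}(w)}[w]_{A_2}^2$ is sharp: there do not exist $\alpha<2$ and $C<\infty$ such that $$\|\Pi_b:L^2(w)\to L^2(w^{-1})\|\le C\,\|b\|_{BMO^{\mathcal{D}}(w)}\,[w]_{A_2}^{\alpha}$$ for all $w\in A_2^{\mathcal{D}}$ on $\mathbb{R}$ and all $b\in BMO^{\mathcal{D}}(w)$.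
   Context: $\mathcal{D}$ is a fixed dyadic grid on $\mathbb{R}$: a collection of intervals of lengths $2^k$, $k\in\mathbb{Z}$, such that for each fixed $k$ those of length $2^k$ partition $\mathbb{R}$, and $I\cap J\in\{I,J,\emptyset\}$ for all $I,J\in\mathcal{D}$. $h_I=|I|^{-1/2}(\mathbf{1}_{I_+}-\mathbf{1}_{I_-})$ with $I_+,I_-$ the right and left halves of $I$; $(f,g)=\int fg\,dx$; $\langle f\rangle_I=\frac1{|I|}\int_If\,dx$; $w(I)=\int_Iw\,dx$. A weight is a locally integrable, a.e. positive function; $L^2(w)$ is $L^2$ of the measure $w\,dx$. $w\in A_2^{\mathcal{D}}$ means $[w]_{A_2}:=\sup_{I\in\mathcal{D}}\langle w\rangle_I\langle w^{-1}\rangle_I<\infty$. $\|b\|_{BMO^{\mathcal{D}}(w)}=\sup_{I\in\mathcal{D}}\frac1{w(I)}\int_I|b-\langle b\rangle_I|\,dx$. $\Pi_bf=\sum_{I\in\mathcal{D}}(b,h_I)\langle f\rangle_Ih_I$ is the paraproduct with symbol $b$, and $S_{\mathcal{D}}f=\big(\sum_{I\in\mathcal{D}}(f,h_I)^2\frac{\mathbf{1}_I}{|I|}\big)^{1/2}$ is the dyadic square function. $\|T:X\to Y\|$ is the operator norm. It is a known fact that the bound $\|S_{\mathcal{D}}:L^2(w)\to L^2(w)\|\lesssim[w]_{A_2}$ holds and that the power $1$ of $[w]_{A_2}$ in it cannot be lowered. *)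

(* Defs.v *)
From mathcomp Require Import all_boot all_order all_algebra.
From mathcomp Require Import all_classical all_reals all_analysis.

Set Implicit Arguments.
Unset Strict Implicit.
Unset Printing Implicit Defensive.

Import Order.TTheory GRing.Theory Num.Theory.
Import numFieldNormedType.Exports.

Local Open Scope classical_set_scope.
Local Open Scope ring_scope.

Section defs.
Context {R : realType}.
Implicit Types (I : set R) (D : set (set R)) (b f g v w : R -> R).

Local Notation mu := (@lebesgue_measure R).

(* The intervals may be open, closed or half-open; they may differ from one
   another in this respect, as long as each generation partitions the line. *)
Definition dyadic_grid D :=
  [/\ forall I, D I -> is_interval I /\ exists k : int, mu I = (2 ^ k)%:E,
      forall k : int, partition [set I | D I /\ mu I = (2 ^ k)%:E] id setT &
      forall I J, D I -> D J -> [\/ I `&` J = I, I `&` J = J | I `&` J = set0]].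

Definition midpoint I : R := (inf I + sup I) / 2.

(* Which half receives the midpoint is immaterial (a null set). *)
Definition left_half I : set R := I `&` [set x | x < midpoint I].
Definition right_half I : set R := I `&` [set x | midpoint I <= x].

Definition haar I (x : R) : R :=
  (Num.sqrt (fine (mu I)))^-1 * (\1_(right_half I) x - \1_(left_half I) x).

Definition inner f g : R := \int[mu]_x (f x * g x).

Definition mean f I : R := (\int[mu]_(x in I) f x) / fine (mu I).

(* The mean as an extended real: the mean of w^-1 may be infinite a priori. *)
Definition emean f I : \bar R := ((\int[mu]_(x in I) (f x)%:E) / mu I)%E.

Definition weight w :=
  locally_integrable setT w /\ {ae mu, forall x, 0 < w x}.

Definition wmeas w I : \bar R := (\int[mu]_(x in I) (w x)%:E)%E.

Definition winv w : R -> R := fun x => (w x)^-1.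

Definition A2const D w : \bar R :=
  ereal_sup [set (emean w I * emean (winv w) I)%E | I in D].

Definition A2 D w := weight w /\ (A2const D w < +oo)%E.

Definition bmo_norm D w b : \bar R :=
  ereal_sup
    [set ((\int[mu]_(x in I) `|b x - mean b I|%:E) / wmeas w I)%E | I in D].

Definition BMO D w : set (R -> R) :=
  [set b | locally_integrable setT b /\ (bmo_norm D w b < +oo)%E].

(* The norm of L^2(v dx). *)
Definition L2norm v (F : R -> \bar R) : \bar R :=
  sqrte (\int[mu]_x (`|F x| ^+ 2 * (v x)%:E))%E.

Definition L2 v : set (R -> R) :=
  [set f | measurable_fun setT f /\ (L2norm v (EFin \o f) < +oo)%E].

(* Operator norm from L^2(u) to L^2(v).  T f is the set of the functions that
   represent the value of the operator at f (they agree almost everywhere); it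
   is empty when f is outside the domain.  The norm is +oo if the operator is
   unbounded or is not defined on all of L^2(u). *)
Definition opnorm (u v : R -> R) (T : (R -> R) -> set (R -> \bar R)) : \bar R :=
  ereal_inf [set C%:E | C in [set C : R | 0 <= C /\
    forall f, L2 u f ->
      exists2 g, T f g & (L2norm v g <= C%:E * L2norm u (EFin \o f))%E]].

Definition square_fun D f (x : R) : \bar R :=
  sqrte (\esum_(I in D) ((inner f (haar I)) ^+ 2 * (\1_I x / fine (mu I)))%:E).

Definition paraproduct_partial (F : set (set R)) b f (x : R) : R :=
  \sum_(I \in F) (inner b (haar I) * mean f I * haar I x).

(* g is the sum of the paraproduct series, which is indexed by the unordered
   set D: the finite partial sums converge to g unconditionally in L^2(v). *)
Definition is_paraproduct D v b f g :=
  L2 v g /\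
  forall e : R, 0 < e ->
    exists2 F0 : set (set R), finite_set F0 /\ F0 `<=` D &
      forall F : set (set R), finite_set F -> F0 `<=` F -> F `<=` D ->
        (L2norm v (fun x => (g x - paraproduct_partial F b f x)%:E) <= e%:E)%E.

Definition square_fun_norm D w : \bar R :=
  opnorm w w (fun f => [set square_fun D f]).

Definition paraproduct_norm D w b : \bar R :=
  opnorm w (winv w)
    (fun f => [set EFin \o g | g in is_paraproduct D (winv w) b f]).

End defs.

(* Main.v *)
Require Import Defs.
From mathcomp Require Import all_boot all_order all_algebra.
From mathcomp Require Import all_classical all_reals all_analysis.
From mathcomp Require Import measurable_realfun ring lra.

Set Implicit Arguments.
Unset Strict Implicit.
Unset Printing Implicit Defensive.

Import Order.TTheory GRing.Theory Num.Theory.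
Import numFieldNormedType.Exports.

Local Open Scope classical_set_scope.
Local Open Scope ring_scope.

(** The extremal symbol for a weight [w] is [w] itself. Multiplication by [w]
    is an isometry of L^2(w) onto L^2(w^-1), and expanding both factors of
    [w f] into martingale differences gives, on the Haar side,
      w f = Pi_w f + (adjoint of Pi_w) f + sum_I <w>_I (f, h_I) h_I.
    Pairing with [f] yields the identity
      ||f||_{L^2(w)}^2 = 2 (Pi_w f, f) + ||S f||_{L^2(w)}^2,
    because the squared norm of [S f] is sum_I <w>_I (f, h_I)^2
    ([L2norm_square_fun]). Hence ||S||^2 <= 1 + 2 ||Pi_w||, which is
    [square_fun_norm_le]. On the other hand the oscillation of [w] on [I] is
    at most 2 w(I), so that [w] has norm at most 2 in BMO(w). If r is the
    supremum in the theorem, then ||S||^2 <= 1 + 4 r. Finally r >= 1/2: a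
    symbol with a single Haar coefficient, tested on the indicator of its
    interval, gives this by the Cauchy-Schwarz inequality
    ([paraproduct_le_haar_step]). So ||S||^2 <= 6 r ([lower_bound]).

    The identity is only used as an inequality, and is derived from a finite
    telescoping sum: for an interval [I] the two terms of the sum attached to
    [I] are the difference between the values of w(K) <f>_K^2 summed over the
    halves K of [I] and its value at [I] ([telescope_step]). Summing over all
    intervals between two generations ([sum_forest]) leaves the values at the
    smallest intervals, which converge to the integral of w f^2 by Lebesgue's
    differentiation theorem when [f] is bounded ([leaves_cvg]); the general
    case follows by truncation ([square_sum_le]).

    For the sharpness, let I_0, I_1, ... be a sequence in which each interval
    is the left half of the preceding one, and let w^-1 be 2^k on I_k outside
    I_{k+1} for k < N, 2^N on I_N, and 1 outside I_0. Then [w]_{A_2} <= N + 1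
    ([A2const_spike_weight]), whereas f = w^-1 - 1 shows that
    ||S|| >= M / 3 when N = 2 M ([square_fun_norm_spike_weight]). Together
    with the lower bound, an estimate with exponent alpha would give
    M^2 / 54 <= C [w]_{A_2}^alpha for all M, which is false for alpha < 2
    ([no_smaller_exponent]). *)

(** * Integrable real functions *)

Section Integrable.
Context {R : realType}.
Implicit Types (A : set R) (f g : R -> R).
Local Notation mu := (@lebesgue_measure R).
Local Notation intg A f := (mu.-integrable A (EFin \o f)).

Lemma intgD A f g : measurable A -> intg A f -> intg A g ->
  intg A (fun x => f x + g x).
Proof.
move=> mA fA gA; rewrite (_ : _ \o _ = (EFin \o f) \+ (EFin \o g))%E//.
exact: integrableD.
Qed.

Lemma intgB A f g : measurable A -> intg A f -> intg A g ->
  intg A (fun x => f x - g x).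
Proof.
move=> mA fA gA; rewrite (_ : _ \o _ = (EFin \o f) \- (EFin \o g))%E//.
exact: integrableB.
Qed.

Lemma intgZ A k f : measurable A -> intg A f -> intg A (fun x => k * f x).
Proof.
move=> mA fA; rewrite (_ : _ \o _ = (fun x => k%:E * (EFin \o f) x))%E//.
exact: integrableZl.
Qed.

Lemma intg_le A f g : measurable A -> measurable_fun A f ->
  (forall x, A x -> `|f x| <= g x) -> intg A g -> intg A f.
Proof.
move=> mA mf fg; apply: le_integrable => //; first exact/measurable_EFinP.
by move=> x Ax /=; rewrite lee_fin (le_trans (fg _ Ax))// ler_norm.
Qed.

Lemma intg_sum (I : eqType) A (s : seq I) (h : I -> R -> R) : measurable A ->
  (forall i, i \in s -> intg A (h i)) -> intg A (fun x => \sum_(i <- s) h i x).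
Proof.
move=> mA; elim: s => [|i s IH] hs.
  by under eq_fun do rewrite big_nil; exact: integrable0.
under eq_fun do rewrite big_cons; apply: intgD => //.
  by apply: hs; rewrite mem_head.
by apply: IH => j js; apply: hs; rewrite in_cons js orbT.
Qed.

Lemma Rintegral_sum (I : eqType) A (s : seq I) (h : I -> R -> R) : measurable A ->
  (forall i, i \in s -> intg A (h i)) ->
  \int[mu]_(x in A) (\sum_(i <- s) h i x) = \sum_(i <- s) \int[mu]_(x in A) h i x.
Proof.
move=> mA; elim: s => [|i s IH] hs.
  by rewrite big_nil; under eq_Rintegral do rewrite big_nil; rewrite Rintegral_cst// mul0r.
under eq_Rintegral do rewrite big_cons.
have hi : intg A (h i) by apply: hs; rewrite mem_head.
have hj j : j \in s -> intg A (h j) by move=> js; apply: hs; rewrite in_cons js orbT.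
by rewrite RintegralD ?big_cons ?IH//; exact: intg_sum.
Qed.

End Integrable.

(** * Geometry of a dyadic grid *)

Section Grid.
Context {R : realType} {D : set (set R)} (hD : dyadic_grid D).
Implicit Types (I J K : set R) (x y : R) (k : int).
Local Notation mu := (@lebesgue_measure R).

Definition len I : R := fine (mu I).

(** The intervals of a grid may be open, closed or half-open; only their
    infimum and their length matter below. *)
Lemma grid_itv I : D I ->
  exists2 k, len I = 2 ^ k &
  exists b0 b1 a, I = [set` Interval (BSide b0 a) (BSide b1 (a + len I))].
Proof.
case: hD => hI _ _ /hI[/is_intervalP itvI [k mI]]; exists k.
  by rewrite /len mI.
have l0 : 0 < 2 ^ k :> R by rewrite exprz_gt0.
have lI : len I = 2 ^ k by rewrite /len mI.
move: mI; rewrite lI itvI lebesgue_measure_itv.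
have no0 : (0 = (2 ^ k)%:E :> \bar R) -> False.
  by move=> h; have := lt_eqF l0; case: h => <-; rewrite eqxx.
case: (Rhull I) => [[b0 a|[]] [b1 b|[]]] //=; rewrite ?lte_fin ?ltry ?ltNyr //;
  try by move=> h; case: (no0 h).
case: ltP => // ab.
move=> /eqP; rewrite -EFinB eqe => /eqP <-.
by exists b0, b1, a; rewrite addrCA subrr addr0.
Qed.

Lemma len_gt0 I : D I -> 0 < len I.
Proof. by move=> /grid_itv[k -> _]; rewrite exprz_gt0. Qed.

Lemma mu_len I : D I -> mu I = (len I)%:E.
Proof. by case: hD => hI _ _ /hI[_ [k]] mI; rewrite /len mI. Qed.

Lemma mu_grid_lty I : D I -> (mu I < +oo)%E.
Proof. by move=> DI; rewrite mu_len// ltry. Qed.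

Lemma measurable_grid I : D I -> measurable I.
Proof. by move=> /grid_itv[k _ [b0 [b1 [a ->]]]]; exact: measurable_itv. Qed.

Lemma grid_sup I : D I -> sup I = inf I + len I.
Proof.
move=> DI; have l0 := len_gt0 DI.
move: DI => /grid_itv[k _ [b0 [b1 [a Ie]]]].
have h : (BSide b0 a < BSide b1 (a + len I))%O.
  by case: b0 b1 {Ie} => [] []; rewrite bnd_simp; lra.
by rewrite [in sup I]Ie [in inf I]Ie inf_itv// sup_itv.
Qed.

Lemma grid_bnd I x : D I -> I x -> inf I <= x <= inf I + len I.
Proof.
move=> DI; have l0 := len_gt0 DI.
move: DI => /grid_itv[k _ [b0 [b1 [a Ie]]]].
have h : (BSide b0 a < BSide b1 (a + len I))%O.
  by case: b0 b1 {Ie} => [] []; rewrite bnd_simp; lra.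
rewrite [in inf I]Ie inf_itv// {1}Ie.
by case: b0 b1 {Ie h} => [] [] /=; rewrite in_itv /=; lra.
Qed.

Lemma grid_in I x : D I -> inf I < x < inf I + len I -> I x.
Proof.
move=> DI; have l0 := len_gt0 DI.
move: DI => /grid_itv[k _ [b0 [b1 [a Ie]]]].
have h : (BSide b0 a < BSide b1 (a + len I))%O.
  by case: b0 b1 {Ie} => [] []; rewrite bnd_simp; lra.
rewrite [in inf I]Ie inf_itv// [X in _ -> X _]Ie.
by case: b0 b1 {Ie h} => [] [] /=; rewrite in_itv /=; lra.
Qed.

Lemma grid_midpoint I : D I -> midpoint I = inf I + len I / 2.
Proof. by move=> DI; rewrite /midpoint grid_sup//; lra. Qed.

Lemma grid_cover k x : exists I, [/\ D I, len I = 2 ^ k & I x].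
Proof.
case: hD => _ /(_ k)[cv _ _] _.
have : setT x by []. 
rewrite -cv => -[I [DI mI] Ix]; exists I; split => //.
by rewrite /len mI.
Qed.

Lemma grid_uniq I J x : D I -> D J -> len I = len J -> I x -> J x -> I = J.
Proof.
move=> DI DJ lIJ Ix Jx; have [k lI _] := grid_itv DI.
case: hD => _ /(_ k)[_ tr _] _; apply: tr; rewrite /= ?mu_len//.
- by rewrite lI.
- by rewrite -lIJ lI.
- by exists x.
Qed.

Lemma grid_nested I J x : D I -> D J -> I x -> J x -> len I <= len J -> I `<=` J.
Proof.
move=> DI DJ Ix Jx lIJ; case: hD => _ _ /(_ I J DI DJ)[].
- by move=> <-; exact: subIsetr.
- move=> JI; have JsI : J `<=` I by rewrite -JI; exact: subIsetl.
  suff -> : I = J by [].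
  apply: (grid_uniq DI DJ _ Ix Jx); apply/eqP; rewrite eq_le lIJ /=.
  rewrite -lee_fin -!mu_len// le_measure// inE; exact: measurable_grid.
- by move=> IJ0; have : (I `&` J) x by []; rewrite IJ0.
Qed.

Lemma subset_grid I J : D I -> D J -> I `<=` J ->
  inf J <= inf I /\ inf I + len I <= inf J + len J.
Proof.
move=> DI DJ IJ; have lI := len_gt0 DI; have lJ := len_gt0 DJ.
split; rewrite leNgt; apply/negP => h.
- pose y := Num.min (inf J) (inf I + len I).
  have /(grid_in DI)/IJ/(grid_bnd DJ) : inf I < (inf I + y) / 2 < inf I + len I.
    by rewrite /y minEle; case: ifP => [|/negbT]; lra.
  by rewrite /y minEle; case: ifP => [|/negbT]; lra.
- pose y := Num.max (inf J + len J) (inf I).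
  have /(grid_in DI)/IJ/(grid_bnd DJ) :
      inf I < (inf I + len I + y) / 2 < inf I + len I.
    by rewrite /y maxEle; case: ifP => [|/negbT]; lra.
  by rewrite /y maxEle; case: ifP => [|/negbT]; lra.
Qed.

Lemma subset_len I J : D I -> D J -> I `<=` J -> len I <= len J.
Proof. by move=> DI DJ /(subset_grid DI DJ)[]; lra. Qed.

(** Two overlapping intervals of equal length share the midpoint of the
    segment joining their centres, so they coincide. *)
Lemma grid_apart I J : D I -> D J -> len I = len J -> I <> J ->
  inf I + len I <= inf J \/ inf J + len J <= inf I.
Proof.
move=> DI DJ lIJ IJ; have lI := len_gt0 DI.
have [|ab] := leP (inf I + len I) (inf J); first by left.
have [|ba] := leP (inf J + len J) (inf I); first by right.
exfalso; apply: IJ.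
pose y := (inf I + inf J + len I) / 2.
by apply: (@grid_uniq I J y) => //; apply: grid_in => //; rewrite /y; lra.
Qed.

Lemma half_len I : D I -> exists k, len I / 2 = 2 ^ k.
Proof.
move=> /grid_itv[k -> _]; exists (k - 1).
by rewrite expfzDr ?exprN1.
Qed.

(** The halves of [I] are taken in the grid, as the intervals of half the
    length at the first and third quartiles of [I]. They agree with
    [left_half I] and [right_half I] up to the midpoint. *)
Definition lchild I : set R :=
  xget set0 [set J | [/\ D J, len J = len I / 2 & J (inf I + len I / 4)]].
Definition rchild I : set R :=
  xget set0 [set J | [/\ D J, len J = len I / 2 & J (inf I + 3 * len I / 4)]].

Section Children.
Variables (I : set R) (DI : D I).

Lemma lchildP : [/\ D (lchild I), len (lchild I) = len I / 2 &
  lchild I (inf I + len I / 4)].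
Proof.
have l0 := len_gt0 DI.
have [k kE] := half_len DI.
have [J [? ? ?]] := grid_cover k (inf I + len I / 4).
by rewrite /lchild; case: xgetP => [//|/(_ J)]; rewrite kE; case; split.
Qed.

Lemma rchildP : [/\ D (rchild I), len (rchild I) = len I / 2 &
  rchild I (inf I + 3 * len I / 4)].
Proof.
have l0 := len_gt0 DI.
have [k kE] := half_len DI.
have [J [? ? ?]] := grid_cover k (inf I + 3 * len I / 4).
by rewrite /rchild; case: xgetP => [//|/(_ J)]; rewrite kE; case; split.
Qed.

Lemma grid_lchild : D (lchild I). Proof. by have [] := lchildP. Qed.
Lemma grid_rchild : D (rchild I). Proof. by have [] := rchildP. Qed.
Lemma len_lchild : len (lchild I) = len I / 2. Proof. by have [] := lchildP. Qed.
Lemma len_rchild : len (rchild I) = len I / 2. Proof. by have [] := rchildP. Qed.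

Lemma lchild_sub : lchild I `<=` I.
Proof.
have l0 := len_gt0 DI.
have [DL lL Lx] := lchildP.
apply: (grid_nested DL DI Lx); last by rewrite lL; lra.
by apply: grid_in => //; lra.
Qed.

Lemma rchild_sub : rchild I `<=` I.
Proof.
have l0 := len_gt0 DI.
have [DL lL Lx] := rchildP.
apply: (grid_nested DL DI Lx); last by rewrite lL; lra.
by apply: grid_in => //; lra.
Qed.

(** A gap between the left ends of [I] and of its left child would have to
    contain another interval of half the length of [I], but the gap is at most
    a quarter of [I] since the child contains the first quartile. *)
Lemma inf_lchild : inf (lchild I) = inf I.
Proof.
have l0 := len_gt0 DI.
have [DL lL Lx] := lchildP; have := grid_bnd DL Lx.
have [a1 a2] := subset_grid DL DI lchild_sub.
move=> b; apply/eqP; rewrite eq_le a1 andbT leNgt; apply/negP => h.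
pose y := (inf I + inf (lchild I)) / 2.
have Iy : I y by apply: grid_in => //; rewrite /y; lra.
have [k kE] := half_len DI.
have [K [DK lK Ky]] := grid_cover k y.
have lKL : len K = len (lchild I) by rewrite lL lK kE.
have KI : K `<=` I by apply: (grid_nested DK DI Ky Iy); rewrite lKL; lra.
have [b1 b2] := subset_grid DK DI KI.
have c := grid_bnd DK Ky.
have nKL : K <> lchild I.
  by move=> KL; move: Ky; rewrite KL => /(grid_bnd DL); rewrite /y; lra.
have [|] := grid_apart DK DL lKL nKL.
- by lra.
- by move: c; rewrite /y; lra.
Qed.

Lemma inf_rchild : inf (rchild I) = inf I + len I / 2.
Proof.
have l0 := len_gt0 DI.
have [DL lL Lx] := rchildP; have := grid_bnd DL Lx.
have [a1 a2] := subset_grid DL DI rchild_sub.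
move=> b; apply/eqP; rewrite eq_le; apply/andP; split; first by lra.
rewrite leNgt; apply/negP => h.
pose y := (inf I + len I + inf (rchild I) + len I / 2) / 2.
have Iy : I y by apply: grid_in => //; rewrite /y; lra.
have [k kE] := half_len DI.
have [K [DK lK Ky]] := grid_cover k y.
have lKL : len K = len (rchild I) by rewrite lL lK kE.
have KI : K `<=` I by apply: (grid_nested DK DI Ky Iy); rewrite lKL; lra.
have [b1 b2] := subset_grid DK DI KI.
have c := grid_bnd DK Ky.
have nKL : K <> rchild I.
  by move=> KL; move: Ky; rewrite KL => /(grid_bnd DL); rewrite /y; lra.
have [|] := grid_apart DK DL lKL nKL.
- by move: c; rewrite /y; lra.
- by lra.
Qed.

Lemma children_disj x : lchild I x -> rchild I x -> False.
Proof.
have l0 := len_gt0 DI.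
move=> Lx Rx; have := grid_uniq grid_lchild grid_rchild _ Lx Rx.
rewrite len_lchild len_rchild => /(_ erefl)/(congr1 inf).
by rewrite inf_lchild inf_rchild; lra.
Qed.

Lemma half_sub_child K : D K -> len K = len I / 2 -> K `<=` I ->
  K = lchild I \/ K = rchild I.
Proof.
have l0 := len_gt0 DI.
move=> DK lK KI; have [b1 b2] := subset_grid DK DI KI.
have [|nL] := pselect (K = lchild I); first by left.
have [|nR] := pselect (K = rchild I); first by right.
exfalso.
have := grid_apart DK grid_lchild _ nL; rewrite len_lchild inf_lchild => /(_ lK).
have := grid_apart DK grid_rchild _ nR; rewrite len_rchild inf_rchild => /(_ lK).
by move=> [] ? [] ?; lra.
Qed.

Lemma children_cover x : I x -> lchild I x \/ rchild I x.
Proof.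
have l0 := len_gt0 DI.
move=> Ix; have [k kE] := half_len DI.
have [K [DK lK Kx]] := grid_cover k x.
have KI : K `<=` I by apply: (grid_nested DK DI Kx Ix); rewrite lK -kE; lra.
by have [<-|<-] := half_sub_child DK (etrans lK (esym kE)) KI; [left|right].
Qed.

Lemma childrenE : lchild I `|` rchild I = I.
Proof.
have l0 := len_gt0 DI.
apply/seteqP; split=> [x [/lchild_sub|/rchild_sub]//|x]; exact: children_cover.
Qed.

Lemma grid_sub_child J : D J -> J `<=` I -> J <> I ->
  J `<=` lchild I \/ J `<=` rchild I.
Proof.
have l0 := len_gt0 DI.
move=> DJ JI nJI.
have [k kJ _] := grid_itv DJ; have [m mI _] := grid_itv DI.
have lJ := len_gt0 DJ.
have x0 : J (inf J + len J / 2) by apply: grid_in => //; lra.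
have lJI : len J <= len I / 2.
  have : len J < len I.
    rewrite lt_neqAle (subset_len DJ DI JI) andbT; apply/eqP => e; apply: nJI.
    by apply: (grid_uniq DJ DI e x0); exact: JI.
  have -> : len I / 2 = 2 ^ (m - 1) by rewrite mI expfzDr ?exprN1.
  by rewrite kJ mI ltr_eXz2l ?ltr1n// ler_eXz2l ?ltr1n// -ltzD1 subrK.
have [Lx|Rx] := children_cover (JI _ x0).
  by left; apply: (grid_nested DJ grid_lchild x0 Lx); rewrite len_lchild.
by right; apply: (grid_nested DJ grid_rchild x0 Rx); rewrite len_rchild.
Qed.

End Children.

Lemma left_half_child I : D I ->
  left_half I `<=` lchild I /\ lchild I `<=` left_half I `|` [set midpoint I].
Proof.
move=> DI; have l0 := len_gt0 DI; split.
- move=> x [Ix] /=; rewrite grid_midpoint// => h.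
  have [//|/(grid_bnd (grid_rchild DI))] := children_cover DI Ix.
  by rewrite inf_rchild//; lra.
- move=> x Lx; have Ix := lchild_sub DI Lx.
  have := grid_bnd (grid_lchild DI) Lx.
  rewrite inf_lchild// len_lchild// => h.
  have [e|ne] := eqVneq x (midpoint I); [by right|left; split => //=].
  by move: ne; rewrite lt_neqAle => ->/=; rewrite grid_midpoint//; lra.
Qed.

Lemma right_half_child I : D I ->
  rchild I `<=` right_half I /\ right_half I `<=` rchild I `|` [set midpoint I].
Proof.
move=> DI; have l0 := len_gt0 DI; split.
- move=> x Rx; have := grid_bnd (grid_rchild DI) Rx.
  rewrite inf_rchild// => h; split; first exact: (rchild_sub DI).
  by rewrite /= grid_midpoint//; lra.
- move=> x [Ix] /=; have := grid_midpoint DI => ->.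
  have [Lx|Rx] := children_cover DI Ix; [|by left].
  move: (grid_bnd (grid_lchild DI) Lx); rewrite inf_lchild// len_lchild// => a b.
  by right; rewrite /=; lra.
Qed.

(** An interval is determined by its generation and a rational point in it. *)
Lemma countable_grid : countable D.
Proof.
pose g (p : int * rat) := xget set0 [set I | [/\ D I, len I = 2 ^ p.1 & I (ratr p.2)]].
apply: (@sub_countable _ _ _ [set: int * rat]); last exact: countableP.
apply: card_le_trans (card_image_le g setT).
apply: subset_card_le => I DI; have [k lI _] := grid_itv DI.
have l0 := len_gt0 DI.
have [q qI] : exists q, ratr q \in `]inf I, (inf I + len I)[ by apply: rat_in_itvoo; lra.
have Iq : I (ratr q) by apply: grid_in => //; move: qI; rewrite in_itv.
exists (k, q) => //; rewrite /g; case: xgetP => [J -> /= [DJ lJ Jq]|/(_ I)[]//].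
by apply: (grid_uniq DJ DI _ Jq Iq); rewrite lI lJ.
Qed.

End Grid.

(** * Haar coefficients and the telescoping identity *)

Section Haar.
Context {R : realType} {D : set (set R)} (hD : dyadic_grid D).
Implicit Types (I J K : set R) (x y : R) (f g w b : R -> R).
Local Notation mu := (@lebesgue_measure R).
Local Notation intg I f := (mu.-integrable I (EFin \o f)).
Local Notation lchild := (lchild (D := D)).
Local Notation rchild := (rchild (D := D)).

(** Used to replace the half-intervals in the definition of the Haar function
    by intervals of the grid: they differ by at most the midpoint. *)
Lemma Rintegral_add_pt (A B : set R) c f : measurable A -> measurable B ->
  A `<=` B -> B `<=` A `|` [set c] -> intg B f ->
  \int[mu]_(x in A) f x = \int[mu]_(x in B) f x.
Proof.
move=> mA mB AB BA fB.
have BE : B = A `|` (B `\` A).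
  apply/seteqP; split=> x; last by case => [/AB//|[]].
  by move=> Bx; have [|] := pselect (A x); [left|right].
rewrite [in RHS]BE Rintegral_setU//; last 3 first.
- exact: measurableD.
- by rewrite -BE.
- by apply/disj_setPS => x [Ax []].
have [->|] := eqVneq (B `\` A) set0; first by rewrite Rintegral_set0 addr0.
move=> /set0P[y [By nAy]].
have -> : B `\` A = [set c].
  apply/seteqP; split=> [x [/BA[//|//]]|x ->].
  by case: (BA _ By) => // <-.
by rewrite Rintegral_set1 addr0.
Qed.

Lemma intg_patch (A : set R) f : measurable A -> intg A f -> intg setT (f \_ A).
Proof.
move=> mA fA; rewrite -restrict_EFin.
have h := integrable_mkcond (mu := mu) (EFin \o f) mA.
exact/h.
Qed.

Lemma intg_cst I (c : R) : D I -> intg I (fun=> c).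
Proof.
move=> DI; apply: measurable_bounded_integrable => //.
- exact: (measurable_grid hD).
- exact: (mu_grid_lty hD).
- by exists `|c|; split; [exact: num_real|move=> y cy x _; exact: ltW].
Qed.

Lemma emean_fin f I : D I -> intg I f -> emean f I = (mean f I)%:E.
Proof.
move=> DI fI; have l0 := len_gt0 hD DI.
rewrite /emean (mu_len hD DI) inver gt_eqF// -[X in (X * _)%E]fineK//.
by apply: integrable_fin_num => //; exact: (measurable_grid hD).
Qed.

Lemma measurable_left_half I : D I -> measurable (left_half I).
Proof.
move=> DI; apply: measurableI; first exact: (measurable_grid hD).
by rewrite (_ : mkset _ = `]-oo, midpoint I[%classic) //; apply/seteqP; split=> x /=; rewrite in_itv.
Qed.

Lemma measurable_right_half I : D I -> measurable (right_half I).
Proof.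
move=> DI; apply: measurableI; first exact: (measurable_grid hD).
by rewrite (_ : mkset _ = `[midpoint I, +oo[%classic) //; apply/seteqP; split=> x /=; rewrite in_itv/= andbT.
Qed.

Lemma halves_disj I x : left_half I x -> right_half I x -> False.
Proof. by move=> [_ /= h1] [_ /= h2]; move: (lt_le_trans h1 h2); rewrite ltxx. Qed.

Lemma halves_cover I x : I x -> left_half I x \/ right_half I x.
Proof.
move=> Ix; have [h|h] := ltP x (midpoint I); [left|right]; by split.
Qed.

Lemma haar_out I x : ~ I x -> haar I x = 0.
Proof.
move=> nIx; rewrite /haar !indicE !memNset ?subrr ?mulr0// => -[]//.
Qed.

Lemma haar_sqr I x : D I -> haar I x ^+ 2 = \1_I x / len I.
Proof.
move=> DI; have l0 := len_gt0 hD DI.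
have [Ix|nIx] := pselect (I x); last first.
  by rewrite haar_out// indicE memNset// expr0n/= mul0r.
rewrite /haar exprMn exprVn sqr_sqrtr ?(ltW l0)// [\1_I x]indicE mem_set// mul1r.
have [Lx|Rx] := halves_cover Ix; rewrite !indicE ?(mem_set Lx) ?(mem_set Rx) memNset.
- by rewrite sub0r sqrrN expr1n mulr1.
- by move=> Rx; exact: (halves_disj Lx Rx).
- by rewrite subr0 expr1n mulr1.
- by move=> Lx; exact: (halves_disj Lx Rx).
Qed.

Lemma measurable_haar I : D I -> measurable_fun setT (haar I).
Proof.
move=> DI; apply: measurable_funM => //; apply: measurable_funB;
  apply: measurable_indic; [exact: measurable_right_half|exact: measurable_left_half].
Qed.

Lemma mul_haarE I f x : f x * haar I x =
  (Num.sqrt (len I))^-1 * ((f \_ (right_half I)) x - (f \_ (left_half I)) x).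
Proof.
by rewrite /haar mulrCA mulrBr !patchE !indicE; congr (_ * (_ - _));
  case: ifP; rewrite ?mulr1 ?mulr0.
Qed.

Section OneInterval.
Variables (I : set R) (DI : D I).
Let mI : measurable I := measurable_grid hD DI.
Let mL : measurable (lchild I) := measurable_grid hD (grid_lchild hD DI).
Let mR : measurable (rchild I) := measurable_grid hD (grid_rchild hD DI).

Lemma intg_half f : intg I f -> intg (left_half I) f /\ intg (right_half I) f.
Proof.
move=> If; split; apply: integrableS If => //; try exact: subIsetl.
  exact: measurable_left_half.
exact: measurable_right_half.
Qed.

Lemma intg_children f : intg I f -> intg (lchild I) f /\ intg (rchild I) f.
Proof.
move=> If; split; apply: integrableS If => //.
  exact: (lchild_sub hD).
exact: (rchild_sub hD).
Qed.

Lemma intg_mul_haar f : intg I f -> intg setT (fun x => f x * haar I x).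
Proof.
move=> If; have [Lf Rf] := intg_half If.
under eq_fun do rewrite mul_haarE.
apply: intgZ => //; apply: intgB => //; apply: intg_patch => //.
  exact: measurable_right_half.
exact: measurable_left_half.
Qed.

Lemma inner_haar f : intg I f -> inner f (haar I) =
  (Num.sqrt (len I))^-1 *
  (\int[mu]_(x in rchild I) f x - \int[mu]_(x in lchild I) f x).
Proof.
move=> If; have [Lf Rf] := intg_half If.
have [L1 L2] := left_half_child hD DI; have [R1 R2] := right_half_child hD DI.
have mLh := measurable_left_half DI; have mRh := measurable_right_half DI.
rewrite /inner; under eq_Rintegral do rewrite mul_haarE.
have iL : intg setT (f \_ (left_half I)).
  exact: intg_patch.
have iR : intg setT (f \_ (right_half I)).
  exact: intg_patch.
rewrite RintegralZl//; last exact: intgB.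
rewrite RintegralB// -!Rintegral_mkcond; congr (_ * (_ - _)).
  by rewrite (Rintegral_add_pt _ _ R1 R2).
by rewrite (Rintegral_add_pt _ _ L1 L2)//; have [] := intg_children If.
Qed.

Lemma Rintegral_children f : intg I f ->
  \int[mu]_(x in I) f x =
  \int[mu]_(x in lchild I) f x + \int[mu]_(x in rchild I) f x.
Proof.
move=> If; rewrite -[in LHS](childrenE hD DI) Rintegral_setU//.
  by rewrite childrenE.
by apply/disj_setPS => x [Lx Rx]; exact: (children_disj hD DI Lx Rx).
Qed.

(** With w = W + A and f = F + B on one half, w = W - A and f = F - B on the
    other, the mean of w f^2 over the halves is W F^2 + W B^2 + 2 A F B. The
    increment consists of a term of the square function and of twice a term
    of the pairing of the paraproduct with [f]. *)
Lemma telescope_step w f : intg I w -> intg I f ->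
  \int[mu]_(x in lchild I) w x * mean f (lchild I) ^+ 2 +
  \int[mu]_(x in rchild I) w x * mean f (rchild I) ^+ 2 =
  \int[mu]_(x in I) w x * mean f I ^+ 2 +
  (mean w I * inner f (haar I) ^+ 2 +
   2 * (inner w (haar I) * mean f I * inner f (haar I))).
Proof.
move=> Iw If; have l0 := len_gt0 hD DI.
rewrite !inner_haar// /mean -!/(len _) len_lchild// len_rchild// !Rintegral_children//.
set l := len I; set s := Num.sqrt l.
have s0 : s != 0 by rewrite sqrtr_eq0 -ltNge.
have -> : l = s ^+ 2 by rewrite sqr_sqrtr// ltW.
by field.
Qed.

End OneInterval.

Definition halve (s : seq (set R)) := map lchild s ++ map rchild s.
(** [leaves n s] are the intervals [n] generations below those of [s], and
    [forest n s] are the intervals met on the way, the leaves excluded. *)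
Fixpoint leaves n s := if n is m.+1 then leaves m (halve s) else s.
Fixpoint forest n s := if n is m.+1 then s ++ forest m (halve s) else [::].

Definition generation (l : R) (s : seq (set R)) :=
  uniq s /\ forall I, I \in s -> D I /\ len I = l.

Lemma generation_halve l s : generation l s -> generation (l / 2) (halve s).
Proof.
move=> [us sD]; split; last first.
  move=> I; rewrite mem_cat => /orP[|] /mapP[J /sD[DJ <-] ->].
    by split; [exact: grid_lchild|rewrite len_lchild].
  by split; [exact: grid_rchild|rewrite len_rchild].
have key I J x : I \in s -> J \in s -> I x -> J x -> I = J.
  move=> /sD[DI lI] /sD[DJ lJ]; apply: (grid_uniq hD DI DJ).
  by rewrite lI lJ.
rewrite cat_uniq !map_inj_in_uniq ?us ?andbT /=.
- apply/hasPn => K /mapP[J Js ->]; apply/negP => /mapP[I Is e].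
  have [DI _] := sD _ Is; have [DJ _] := sD _ Js.
  have [_ _ h] := rchildP hD DJ.
  have IJ : I = J.
    apply: (key _ _ _ Is Js _ (rchild_sub hD DJ h)).
    by apply: (lchild_sub hD DI); rewrite -e.
  by rewrite IJ in e; apply: (children_disj hD DJ _ h); rewrite -e.
- move=> I J Is Js e; have [DI _] := sD _ Is; have [DJ _] := sD _ Js.
  have [_ _ h] := rchildP hD DJ.
  apply: (key _ _ _ Is Js _ (rchild_sub hD DJ h)).
  by apply: (rchild_sub hD DI); rewrite e.
- move=> I J Is Js e; have [DI _] := sD _ Is; have [DJ _] := sD _ Js.
  have [_ _ h] := lchildP hD DJ.
  apply: (key _ _ _ Is Js _ (lchild_sub hD DJ h)).
  by apply: (lchild_sub hD DI); rewrite e.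
Qed.

Lemma generation_leaves n l s : generation l s -> generation (l / 2 ^+ n) (leaves n s).
Proof.
elim: n l s => [|n IH] l s ls /=; first by rewrite expr0 divr1.
by rewrite exprS invfM mulrA; apply: IH; exact: generation_halve.
Qed.

Lemma forest_spec n l s : generation l s -> uniq (forest n s) /\
  forall I, I \in forest n s -> D I /\ len I <= l.
Proof.
elim: n l s => [//|n IH] l s ls /=.
have [us sD] := ls; have [uf fD] := IH _ _ (generation_halve ls).
split; last first.
  move=> I; rewrite mem_cat => /orP[/sD[DI ->//]|/fD[DI lI]].
  by split => //; have := len_gt0 hD DI; lra.
rewrite cat_uniq us uf andbT /=; apply/hasPn => I /fD[DI lI].
by apply/negP => /sD[_]; have := len_gt0 hD DI; lra.
Qed.

Lemma mem_forest n l s I J : generation l s -> I \in s -> D J -> J `<=` I ->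
  l < len J * 2 ^+ n -> J \in forest n s.
Proof.
elim: n l s I => [|n IH] l s I ls Is DJ JI /=; have [DI lI] := ls.2 _ Is.
  by rewrite expr0 mulr1 -lI ltNge (subset_len hD DJ DI JI).
move=> h; rewrite mem_cat.
have [->|nJI] := pselect (J = I); first by rewrite Is.
apply/orP; right; have [JL|JR] := grid_sub_child hD DI DJ JI nJI.
  apply: (IH (l / 2) _ (lchild I)) => //; first exact: generation_halve.
    by rewrite mem_cat map_f.
  by move: h; rewrite exprS; lra.
apply: (IH (l / 2) _ (rchild I)) => //; first exact: generation_halve.
  by rewrite mem_cat map_f// orbT.
by move: h; rewrite exprS; lra.
Qed.

Lemma sum_leaves n l s f : generation l s -> (forall I, I \in s -> intg I f) ->
  \sum_(K <- leaves n s) \int[mu]_(x in K) f x =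
  \sum_(I <- s) \int[mu]_(x in I) f x.
Proof.
elim: n l s => [//|n IH] l s ls sf /=.
rewrite (IH (l / 2)); last 2 first.
- exact: generation_halve.
- move=> I; rewrite mem_cat => /orP[|] /mapP[J Js ->]; have [DJ _] := ls.2 _ Js;
  by case: (intg_children DJ (sf _ Js)).
rewrite big_cat /= !big_map -big_split /= big_seq [RHS]big_seq.
by apply: eq_bigr => I Is; have [DI _] := ls.2 _ Is; rewrite [RHS]Rintegral_children// sf.
Qed.

(** [telescope_step], summed over the forest. *)
Lemma sum_forest n l s w f : generation l s ->
  (forall I, I \in s -> intg I w) -> (forall I, I \in s -> intg I f) ->
  \sum_(K <- leaves n s) \int[mu]_(x in K) w x * mean f K ^+ 2 =
  \sum_(I <- s) \int[mu]_(x in I) w x * mean f I ^+ 2 +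
  (\sum_(I <- forest n s) mean w I * inner f (haar I) ^+ 2 +
   2 * \sum_(I <- forest n s)
     inner w (haar I) * mean f I * inner f (haar I)).
Proof.
elim: n l s => [|n IH] l s ls sw sf /=; first by rewrite !big_nil mulr0 !addr0.
have ik g : (forall I, I \in s -> intg I g) -> forall I, I \in halve s -> intg I g.
  by move=> sg I; rewrite mem_cat => /orP[|] /mapP[J Js ->];
  have [DJ _] := ls.2 _ Js; case: (intg_children DJ (sg _ Js)).
rewrite (IH (l / 2))//; [|exact: generation_halve|exact: ik|exact: ik].
rewrite !big_cat /= !big_map.
have h : \sum_(I <- s) (\int[mu]_(x in lchild I) w x * mean f (lchild I) ^+ 2 +
      \int[mu]_(x in rchild I) w x * mean f (rchild I) ^+ 2) =
    \sum_(I <- s) (\int[mu]_(x in I) w x * mean f I ^+ 2 +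
      (mean w I * inner f (haar I) ^+ 2 +
       2 * (inner w (haar I) * mean f I * inner f (haar I)))).
  by apply: eq_big_seq => I Is; apply: telescope_step;
    [exact: (ls.2 _ Is).1|exact: sw|exact: sf].
move: h; rewrite !big_split /= => h; rewrite [X in X + _ = _]h -!addrA mulrDr -!mulr_sumr.
by ring.
Qed.

Lemma pow2_unbounded (x : R) : exists n, x < 2 ^+ n.
Proof.
exists (Num.bound `|x|).
apply: (le_lt_trans (ler_norm x)).
apply: (lt_trans (archi_boundP (normr_ge0 x))).
by rewrite -natrX ltr_nat ltn_expl.
Qed.

Lemma grid_ancestor J k : D J -> len J <= 2 ^ k ->
  exists I, [/\ D I, len I = 2 ^ k & J `<=` I].
Proof.
move=> DJ h; have lJ := len_gt0 hD DJ.
have Jx : J (inf J + len J / 2) by apply: (grid_in hD) => //; lra.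
have [I [DI lI Ix]] := grid_cover hD k (inf J + len J / 2).
by exists I; split => //; apply: (grid_nested hD DJ DI Jx Ix); rewrite lI.
Qed.

(** A grid may split the line into two half-lines without common ancestors,
    so one tree need not contain all the intervals of [F]; finitely many roots
    of the same length always suffice. *)
Lemma forest_exhausts (F : seq (set R)) : (forall J, J \in F -> D J) ->
  exists k s, generation (2 ^ k) s /\
    exists n0, forall n, (n0 <= n)%N -> {subset F <= forest n s}.
Proof.
move=> FD.
have [m mP] := pow2_unbounded (\sum_(J <- F) len J).
have lm J : J \in F -> len J <= 2 ^ (m : int).
  move=> JF; apply: ltW; apply: le_lt_trans mP.
  rewrite (big_rem J)//= lerDl big_seq sumr_ge0// => K /mem_rem /FD DK.
  by rewrite ltW// (len_gt0 hD).
pose top J := xget set0 [set I | [/\ D I, len I = 2 ^ (m : int) & J `<=` I]].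
have topP J : J \in F -> [/\ D (top J), len (top J) = 2 ^ (m : int) & J `<=` top J].
  move=> JF; have [I IP] := grid_ancestor (FD _ JF) (lm _ JF).
  by rewrite /top; case: xgetP => [K -> //|/(_ I)].
exists m, (undup (map top F)).
have ls : generation (2 ^ (m : int)) (undup (map top F)).
  split; first exact: undup_uniq.
  by move=> I; rewrite mem_undup => /mapP[J /topP[? ? ?] ->].
split => //.
pose N J := sval (cid (pow2_unbounded (2 ^ (m : int) / len J))).
exists (\max_(J <- F) N J)%N => n hn J JF.
have [DI lI JI] := topP _ JF.
apply: (mem_forest ls _ (FD _ JF) JI).
  by rewrite mem_undup map_f.
have := svalP (cid (pow2_unbounded (2 ^ (m : int) / len J))); rewrite -/(N J).
have lJ := len_gt0 hD (FD _ JF).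
rewrite ltr_pdivrMr// mulrC => /lt_le_trans; apply.
rewrite ler_pM2l// ler_eXn2l ?ltr1n//.
by apply: leq_trans hn; exact: leq_bigmax_seq.
Qed.

End Haar.

(** * Convergence of averages along generations *)

Section Limit.
Context {R : realType} {D : set (set R)} (hD : dyadic_grid D).
Implicit Types (I J K : set R) (x y : R) (f g w b : R -> R).
Local Notation mu := (@lebesgue_measure R).
Local Notation intg I f := (mu.-integrable I (EFin \o f)).
Local Notation lchild := (lchild (D := D)).
Local Notation rchild := (rchild (D := D)).
Local Notation leaves := (leaves (D := D)).
Local Notation generation := (generation (D := D)).

Lemma measurable_grid_bigcup (P : set (set R)) : P `<=` D ->
  measurable (\bigcup_(K in P) K).
Proof.
move=> PD; have /countable_injP[j jinj] := countable_grid hD.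
pose F n := xget set0 [set K | P K /\ j K = n].
rewrite (_ : \bigcup_(K in P) K = \bigcup_n F n).
  apply: bigcupT_measurable => n; rewrite /F.
  by case: xgetP => [K -> [/PD DK _]|//]; exact: (measurable_grid hD).
apply/seteqP; split=> x.
  move=> [K PK Kx]; exists (j K) => //; rewrite /F.
  case: xgetP => [L -> [PL jL]|/(_ K) []//].
  by rewrite (_ : xget _ _ = K)//; apply: jinj => //; rewrite inE; exact: PD.
move=> [n _]; rewrite /F; case: xgetP => [L _ [PL jL] Lx|//].
by eexists; [exact: PL|exact: Lx].
Qed.

(** The preimage of any set is a union of intervals, and the grid is
    countable. *)
Lemma measurable_generation_cst k g :
  (forall K x y, D K -> len K = 2 ^ k -> K x -> K y -> g x = g y) ->
  measurable_fun setT g.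
Proof.
move=> gc _ Y mY; rewrite setTI.
rewrite (_ : _ @^-1` _ =
  \bigcup_(K in [set K | [/\ D K, len K = 2 ^ k & exists2 x, K x & Y (g x)]]) K).
  by apply: measurable_grid_bigcup => K [].
apply/seteqP; split=> x.
  move=> Yx; have [K [DK lK Kx]] := grid_cover hD k x.
  by exists K => //; split => //; exists x.
by move=> [K [DK lK [y Ky Yy]] Kx]; rewrite /= (gc K x y).
Qed.

Definition cell k x : set R := xget set0 [set K | [/\ D K, len K = 2 ^ k & K x]].

Lemma cellP k x : [/\ D (cell k x), len (cell k x) = 2 ^ k & cell k x x].
Proof.
have [K KP] := grid_cover hD k x.
by rewrite /cell; case: xgetP => [L -> //|/(_ K)].
Qed.

Lemma cell_uniq k x K : D K -> len K = 2 ^ k -> K x -> cell k x = K.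
Proof.
move=> DK lK Kx; have [DC lC Cx] := cellP k x.
by apply: (grid_uniq hD DC DK _ Cx Kx); rewrite lC lK.
Qed.

Lemma pow2_shrink (k : int) (n : nat) : (2 : R) ^ (k - n%:Z) = 2 ^ k / 2 ^+ n.
Proof. by rewrite expfzDr// -exprnN. Qed.

(** The ball at [x] of radius twice the length of its cell contains the cell
    and has four times its length. *)
Lemma cell_nicely_shrinking (k : int) x :
  nicely_shrinking x (fun n : nat => cell (k - n%:Z) x).
Proof.
split; first by move=> n; have [DC _ _] := cellP (k - n%:Z) x; exact: (measurable_grid hD).
have r0 (n : nat) : (0 : R) < 2 * 2 ^ (k - n%:Z) by rewrite mulr_gt0// exprz_gt0.
exists (4, fun n => PosNum (r0 n)) => /=; split => //.
- have h : 2 * 2 ^ k * 2^-1 ^+ n @[n --> \oo] --> 2 * 2 ^ k * (0 : R).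
    apply: cvgMl_tmp; apply: cvg_expr; rewrite ger0_norm ?invr_ge0//.
    by rewrite invf_lt1// ltr1n.
  rewrite mulr0 in h; under eq_fun do rewrite pow2_shrink mulrA -exprVn.
  exact: h.
- move=> n y Cy; have [DC lC Cx] := cellP (k - n%:Z) x.
  have l0 := len_gt0 hD DC.
  have := grid_bnd hD DC Cx; have := grid_bnd hD DC Cy.
  rewrite lC in l0 * => a b; rewrite ball_itv/= in_itv/=; lra.
- move=> n; have [DC lC Cx] := cellP (k - n%:Z) x.
  rewrite (mu_len hD DC) lC lebesgue_measure_ball ?(ltW (r0 n))// -EFinM lee_fin.
  by rewrite -mulr_natr; lra.
Qed.

Lemma locally_integrable_bounded f M : measurable_fun setT f ->
  (forall x, `|f x| <= M) -> locally_integrable setT f.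
Proof.
move=> mf fM; split => //; first exact: openT.
move=> K _ cK; have mK := compact_measurable cK.
have /integrableP[] // : intg K f.
apply: measurable_bounded_integrable => //.
- exact: compact_finite_measure.
- exact: measurable_funTS.
- by exists M; split; [exact: num_real|move=> y My x _; exact: (le_trans (fM x) (ltW My))].
Qed.

Lemma locally_integrable_intg f I : locally_integrable setT f -> D I -> intg I f.
Proof.
move=> [mf _ fK] DI; have mI := measurable_grid hD DI.
have h : intg `[inf I, inf I + len I]%classic f.
  apply/integrableP; split; last exact: fK (@segment_compact _ _ _).
  by apply/measurable_EFinP; apply: measurable_funS mf.
apply: integrableS h => //.
by move=> x Ix; rewrite /= in_itv/=; exact: (grid_bnd hD).
Qed.

Lemma cell_mean_cvg (k : int) f x : locally_integrable setT f ->
  lebesgue_pt f x -> mean f (cell (k - n%:Z) x) @[n --> \oo] --> f x.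
Proof.
move=> lf fx.
have := nice_lebesgue_differentiation (cell_nicely_shrinking k) lf fx.
move=> /fine_cvg /=; apply: cvg_trans; apply: near_eq_cvg; apply: nearW => n.
have [DC lC Cx] := cellP (k - n%:Z) x; have l0 := len_gt0 hD DC.
have iC := locally_integrable_intg lf DC.
rewrite /= (mu_len hD DC) inver gt_eqF// fineM//; last first.
  by apply: integrable_fin_num => //; exact: (measurable_grid hD).
by rewrite /mean mulrC.
Qed.

Lemma Rintegral_dominated (A : set R) (fn : nat -> R -> R) f g :
  measurable A -> (forall n, measurable_fun A (fn n)) -> measurable_fun A f ->
  {ae mu, forall x, A x -> fn ^~ x @ \oo --> f x} ->
  intg A g -> (forall n x, A x -> `|fn n x| <= g x) ->
  \int[mu]_(x in A) fn n x @[n --> \oo] --> \int[mu]_(x in A) f x.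
Proof.
move=> mA mfn mf cv ig dom.
have [] := @dominated_convergence _ _ _ mu A mA (fun n => EFin \o fn n) (EFin \o f)
  (EFin \o g) => //.
- by move=> n; apply/measurable_EFinP; exact: mfn.
- exact/measurable_EFinP.
- case: cv => N [mN N0 sub]; exists N; split => // x /= nc; apply: sub => /= cx.
  by apply: nc => Ax; apply: cvg_EFin; [exact: nearW|exact: cx].
- by apply: aeW => x n Ax /=; rewrite lee_fin dom.
move=> i1 _ c.
by apply: fine_cvg; rewrite fineK//; exact: integrable_fin_num.
Qed.

(** The sum is the integral of [w] times the square of the average of [f] over
    the cell of the current generation. These averages are bounded by [M] and
    converge to [f] at its Lebesgue points, so dominated convergence applies.
    Boundedness of [f] makes an integrable multiple of [w] the majorant, which
    avoids any maximal inequality. *)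
Lemma leaves_cvg (k : int) s w f M : generation (2 ^ k) s ->
  (forall x, 0 <= w x) -> measurable_fun setT w -> (forall I, D I -> intg I w) ->
  measurable_fun setT f -> (forall x, `|f x| <= M) ->
  \sum_(K <- leaves n s) \int[mu]_(x in K) w x * mean f K ^+ 2 @[n --> \oo]
  --> \sum_(I <- s) \int[mu]_(x in I) (w x * f x ^+ 2).
Proof.
move=> ls w0 mw iw mf fM.
have lf : locally_integrable setT f by exact: locally_integrable_bounded fM.
have M0 : 0 <= M := le_trans (normr_ge0 _) (fM 0).
pose g (n : nat) x := w x * mean f (cell (k - n%:Z) x) ^+ 2.
have gM n x : `|g n x| <= M ^+ 2 * w x.
  rewrite /g ger0_norm; last by rewrite mulr_ge0 ?sqr_ge0.
  rewrite mulrC; apply: ler_wpM2r => //.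
  rewrite -real_normK ?num_real// lerXn2r ?nnegrE//.
  have [DC lC Cx] := cellP (k - n%:Z) x; have l0 := len_gt0 hD DC.
  have iC := locally_integrable_intg lf DC.
  have mC := measurable_grid hD DC.
  rewrite /mean normrM normfV (gtr0_norm l0) ler_pdivrMr//.
  have h := @le_normr_Rintegral _ _ _ mu _ _ mC iC; apply: (le_trans h).
  rewrite -[leRHS](Rintegral_cst mu mC M); apply: le_Rintegral => //.
    exact: integrable_norm.
  have muC : (mu (cell (k - n%:Z) x) < +oo)%E by rewrite (mu_len hD DC) ltry.
  apply: measurable_bounded_integrable => //.
  by exists M; split; [exact: num_real|move=> y My z _ /=; rewrite ger0_norm// ltW].
have mg n : measurable_fun setT (g n).
  apply: measurable_funM => //.
  apply: (@measurable_generation_cst (k - n%:Z)) => K x y DK lK Kx Ky.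
  by rewrite (cell_uniq DK lK Kx) (cell_uniq DK lK Ky).
have ig n I : D I -> intg I (g n).
  move=> DI; have mI := measurable_grid hD DI.
  by apply: (intg_le mI _ (fun x _ => gM n x)); [exact: measurable_funTS|apply: intgZ => //; exact: iw].
under eq_fun => n.
  have ln := generation_leaves hD n ls.
  rewrite (_ : \sum_(K <- _) _ = \sum_(K <- leaves n s) \int[mu]_(x in K) g n x); last first.
    apply: eq_big_seq => K Ks; have [DK lK] := ln.2 _ Ks.
    rewrite -RintegralZr//; last 2 first.
    - exact: (measurable_grid hD).
    - exact: iw.
    apply: eq_Rintegral => x; rewrite inE => Kx.
    by rewrite /g (cell_uniq DK _ Kx)// pow2_shrink.
  rewrite (sum_leaves hD n ls); last by move=> I /ls.2[DI _]; exact: ig.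
  over.
rewrite /=.
have cvI I : I \in s -> \int[mu]_(x in I) g n x @[n --> \oo] -->
    \int[mu]_(x in I) (w x * f x ^+ 2).
  move=> Is; have [DI lI] := ls.2 _ Is; have mI := measurable_grid hD DI.
  apply: (@Rintegral_dominated _ _ _ (fun x => M ^+ 2 * w x)) => //.
  - by move=> n; exact: measurable_funTS.
  - apply: measurable_funTS; apply: measurable_funM => //; exact: measurable_funX.
  - have [N [mN N0 sub]] := lebesgue_differentiation lf.
    exists N; split => // x /= nc; apply: sub => /= fx; apply: nc => Ix.
    apply: cvgMl_tmp; under eq_fun do rewrite expr2.
    by rewrite expr2; apply: cvgM; exact: cell_mean_cvg.
  - apply: intgZ => //; exact: iw.
move: cvI; elim: (s) => [|I t IH] cvI.
  by rewrite big_nil; under eq_fun do rewrite big_nil; exact: cvg_cst.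
rewrite big_cons (_ : (fun n => _) = fun n => \int[mu]_(x in I) g n x +
  \sum_(J <- t) \int[mu]_(x in J) g n x); last first.
  by apply/funext => n; rewrite big_cons.
apply: cvgD; first by apply: cvI; rewrite mem_head.
by apply: IH => J Jt; apply: cvI; rewrite in_cons Jt orbT.
Qed.

(** The intervals of one generation are disjoint. *)
Lemma sum_generation_le l s (h : R -> R) : generation l s -> (forall x, 0 <= h x) ->
  intg setT h -> \sum_(I <- s) \int[mu]_(x in I) h x <= \int[mu]_x h x.
Proof.
move=> ls h0 ih.
have ihI I : I \in s -> intg setT (h \_ I).
  move=> /ls.2[DI _]; have mI := measurable_grid hD DI.
  by apply: intg_patch => //; apply: integrableS ih.
under eq_bigr do rewrite Rintegral_mkcond.
rewrite -Rintegral_sum//; apply: le_Rintegral => //; first exact: intg_sum.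
move=> x _.
have [[I Is Ix]|nI] := pselect (exists2 I, I \in s & I x).
  rewrite (bigD1_seq I) ?ls.1//= [X in _ + X]big1_seq ?addr0; last first.
    move=> J /andP[JI Js]; rewrite patchE memNset// => Jx; move/eqP : JI; apply.
    have [DI lI] := ls.2 _ Is; have [DJ lJ] := ls.2 _ Js.
    by apply: (grid_uniq hD DJ DI _ Jx Ix); rewrite lI lJ.
  by rewrite patchE mem_set.
rewrite big1_seq// => J /andP[_ Js]; rewrite patchE memNset// => Jx.
by apply: nI; exists J.
Qed.

End Limit.

(** * Weighted energies and the norm of the square function *)

Section WeightedNorm.
Context {R : realType}.
Implicit Types (A : set R) (x t : R) (f g u v w b : R -> R).
Local Notation mu := (@lebesgue_measure R).
Local Notation intg A f := (mu.-integrable A (EFin \o f)).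

(** The squared norm of [f] in L^2(v). *)
Definition energy v f : R := \int[mu]_x (f x ^+ 2 * v x).

Lemma L2norm_EFin v f :
  L2norm v (EFin \o f) = sqrte (\int[mu]_x (f x ^+ 2 * v x)%:E)%E.
Proof.
rewrite /L2norm; congr sqrte; apply: eq_integral => x _.
by rewrite /= -!EFinM -expr2 real_normK ?num_real.
Qed.

Lemma sqrte_lty (z : \bar R) : (0 <= z -> (sqrte z < +oo) = (z < +oo))%E.
Proof.
move=> z0; rewrite -!ge0_fin_numE ?sqrte_ge0//.
exact: sqrte_fin_num.
Qed.

Section Nonneg.
Variables (v : R -> R) (mv : measurable_fun setT v) (v0 : forall x, 0 <= v x).

Lemma energy_ge0 f : 0 <= energy v f.
Proof. by apply: Rintegral_ge0 => x _; rewrite mulr_ge0// sqr_ge0. Qed.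

Lemma measurable_sqr_mul f : measurable_fun setT f ->
  measurable_fun setT (fun x => f x ^+ 2 * v x).
Proof. by move=> mf; apply: measurable_funM => //; exact: measurable_funX. Qed.

Lemma L2P f : L2 v f <-> measurable_fun setT f /\ intg setT (fun x => f x ^+ 2 * v x).
Proof.
have n0 x : 0 <= f x ^+ 2 * v x by rewrite mulr_ge0// sqr_ge0.
have i0 : (0 <= \int[mu]_x (f x ^+ 2 * v x)%:E)%E.
  by apply: integral_ge0 => x _; rewrite lee_fin.
split=> [[mf]|[mf i]].
  rewrite L2norm_EFin sqrte_lty// => h; split => //.
  apply/integrableP; split; first by apply/measurable_EFinP; exact: measurable_sqr_mul.
  by under eq_integral do rewrite /= ger0_norm//.
split => //; rewrite L2norm_EFin sqrte_lty//.
move/integrableP : i => [_]; under eq_integral do rewrite /= ger0_norm//.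
by [].
Qed.

Lemma L2normE f : L2 v f -> L2norm v (EFin \o f) = (Num.sqrt (energy v f))%:E.
Proof.
move=> /L2P[mf i]; rewrite L2norm_EFin /energy /Rintegral.
by rewrite -[X in sqrte X]fineK//; exact: integrable_fin_num.
Qed.

Lemma L2norm_le f r : measurable_fun setT f -> 0 <= r ->
  (L2norm v (EFin \o f) <= r%:E)%E -> L2 v f /\ energy v f <= r ^+ 2.
Proof.
move=> mf r0 h.
have Lf : L2 v f by split => //; apply: le_lt_trans h _; rewrite ltry.
split => //; move: h; rewrite L2normE// lee_fin => h.
by rewrite -(sqr_sqrtr (energy_ge0 f)) lerXn2r// nnegrE sqrtr_ge0.
Qed.

End Nonneg.

Section Duality.
Variables (w : R -> R) (mw : measurable_fun setT w) (w0 : forall x, 0 < w x).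

(** Inversion is continuous away from 0. *)
Lemma measurable_winv : measurable_fun setT (winv w).
Proof.
have mV : measurable_fun [set x : R | x != 0] (@GRing.inv R).
  apply: open_continuous_measurable_fun; first exact: open_neq.
  by move=> x /[!inE] x0; exact: inv_continuous.
apply: (measurable_comp _ _ mV mw) => //.
- by apply: open_measurable; exact: open_neq.
- by move=> _ [x _ <-] /=; rewrite gt_eqF.
Qed.

Lemma winv_gt0 x : 0 < winv w x. Proof. by rewrite invr_gt0. Qed.

(** The arithmetic-geometric mean inequality for a and t z c. With [t] at the
    disposal of the user it replaces the Cauchy-Schwarz inequality for the
    pairing of L^2(w) and L^2(w^-1). *)
Lemma amgm_weight t (a c z : R) : 0 < t -> 0 < z ->
  `|a * c| <= 2^-1 * (t^-1 * (a ^+ 2 * z^-1) + t * (c ^+ 2 * z)).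
Proof.
move=> t0 z0; rewrite normrM.
rewrite -(real_normK (num_real a)) -(real_normK (num_real c)).
set A := `|a|; set B := `|c|.
rewrite -subr_ge0 (_ : _ - _ = 2^-1 * (t^-1 * z^-1) * (A - t * z * B) ^+ 2).
  by rewrite mulr_ge0 ?sqr_ge0// mulr_ge0 ?mulr_ge0 ?invr_ge0// ltW.
by field; rewrite !gt_eqF.
Qed.

Lemma pairing_bound t f g : 0 < t -> L2 w f -> L2 (winv w) g ->
  intg setT (fun x => g x * f x) /\
  `|\int[mu]_x (g x * f x)| <= 2^-1 * (t^-1 * energy (winv w) g + t * energy w f).
Proof.
move=> t0 Lf Lg.
have [mf f_i] := (L2P mw (fun x => ltW (w0 x)) f).1 Lf.
have [mg g_i] := (L2P measurable_winv (fun x => ltW (winv_gt0 x)) g).1 Lg.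
have ih : intg setT (fun x => 2^-1 * (t^-1 * (g x ^+ 2 * winv w x) + t * (f x ^+ 2 * w x))).
  by apply: intgZ => //; apply: intgD => //; exact: intgZ.
have b x : `|g x * f x| <= 2^-1 * (t^-1 * (g x ^+ 2 * winv w x) + t * (f x ^+ 2 * w x)).
  exact: amgm_weight.
have i : intg setT (fun x => g x * f x).
  by apply: (intg_le _ _ (fun x _ => b x) ih) => //; exact: measurable_funM.
split => //; apply: (le_trans (le_normr_Rintegral measurableT i)).
apply: (@le_trans _ _ (\int[mu]_x (2^-1 * (t^-1 * (g x ^+ 2 * winv w x) + t * (f x ^+ 2 * w x))))).
  apply: le_Rintegral => //.
  apply: (intg_le _ _ _ ih) => //; last by move=> x _; rewrite normr_id.
  by apply: measurableT_comp => //; exact: measurable_funM.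
rewrite RintegralZl//; last by apply: intgD => //; exact: intgZ.
by rewrite RintegralD//; [|exact: intgZ|exact: intgZ]; rewrite !RintegralZl.
Qed.

End Duality.

End WeightedNorm.

Section SquareFunction.
Context {R : realType} {D : set (set R)} (hD : dyadic_grid D).
Implicit Types (I J K : set R) (x y : R) (f g w b : R -> R).
Local Notation mu := (@lebesgue_measure R).
Local Notation intg I f := (mu.-integrable I (EFin \o f)).

Lemma grid_enum : exists (e : nat -> set R) (P : pred nat),
  set_inj P e /\ [set e n | n in P] = D.
Proof.
have /countable_injP[j jinj] := countable_grid hD.
exists (fun n => xget set0 [set K | D K /\ j K = n]),
  (fun n => `[< exists2 K, D K & j K = n >]).
have eP n : (exists2 K, D K & j K = n) ->
    D (xget set0 [set K | D K /\ j K = n]) /\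
    j (xget set0 [set K | D K /\ j K = n]) = n.
  by move=> [K DK jK]; case: xgetP => [L _//|/(_ K)[]].
split.
- move=> m n; rewrite !inE => pm pn h.
  have [_ h1] := eP m pm; have [_ h2] := eP n pn.
  by rewrite -h1 -h2 h.
- apply/seteqP; split=> [K [n pn <-]|K DK].
    by have [h _] := eP n (asboolW pn).
  have /eP[h1 h2] : exists2 L, D L & j L = j K by exists K.
  exists (j K); first by apply/asboolP; exists K.
  by apply: jinj => //; rewrite inE.
Qed.

Lemma esum_grid : exists (e : nat -> set R) (P : pred nat),
  (forall n, P n -> D (e n)) /\
  forall a : set R -> \bar R, (forall I, D I -> 0 <= a I)%E ->
   (\esum_(I in D) a I = \sum_(n <oo) if P n then a (e n) else 0)%E.
Proof.
have [e [P [inj eD]]] := grid_enum; exists e, P.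
have PD n : P n -> D (e n) by move=> Pn; rewrite -eD; exists n.
split => // a a0; rewrite -[in LHS]eD.
rewrite (esum_pred_image a e P)//; first by rewrite eseries_mkcond.
by move=> n /PD /a0.
Qed.

Definition sq_term f I x : R := inner f (haar I) ^+ 2 * (\1_I x / len I).

Lemma sq_term_ge0 f I x : D I -> 0 <= sq_term f I x.
Proof. by move=> DI; rewrite mulr_ge0 ?sqr_ge0 ?divr_ge0// ltW// (len_gt0 hD). Qed.

Lemma measurable_sq_term f I : D I -> measurable_fun setT (sq_term f I).
Proof.
move=> DI; apply: measurable_funM => //; apply: measurable_funM => //.
apply: measurable_indic; exact: (measurable_grid hD).
Qed.

Lemma square_fun_series : exists (e : nat -> set R) (P : pred nat),
  [/\ forall n, P n -> D (e n),
   forall a : set R -> \bar R, (forall I, D I -> 0 <= a I)%E ->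
     (\esum_(I in D) a I = \sum_(n <oo) if P n then a (e n) else 0)%E &
   forall f x, square_fun D f x =
     sqrte (\sum_(n <oo) if P n then (sq_term f (e n) x)%:E else 0)%E].
Proof.
have [e [P [PD eP]]] := esum_grid; exists e, P; split => // f x.
rewrite /square_fun; congr sqrte; rewrite eP// => I DI.
by rewrite lee_fin; exact: (sq_term_ge0 f x DI).
Qed.

Lemma measurable_square_fun f : measurable_fun setT (square_fun D f).
Proof.
have [e [P [PD _ sE]]] := square_fun_series.
rewrite (_ : square_fun D f = fun x => (\sum_(n <oo) if P n then (sq_term f (e n) x)%:E else 0) `^ 2^-1)%E.
  apply: (measurableT_comp (measurable_poweR _)).
  apply: (@ge0_emeasurable_sum _ _ _ setT
      (fun n x => if P n then (sq_term f (e n) x)%:E else 0)%E xpredT) => n.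
    by move=> x _ _; case: ifPn => // Pn; rewrite lee_fin; apply: sq_term_ge0; exact: PD.
  move=> _ /=; case: (boolP (P n)) => Pn; last exact: measurable_cst.
  by apply/measurable_EFinP; apply: measurable_sq_term; exact: PD.
apply/funext => x; rewrite sE poweR12_sqrt//.
by apply: nneseries_ge0 => n _ _; case: ifPn => // Pn; rewrite lee_fin; apply: sq_term_ge0; exact: PD.
Qed.

(** The integral and the countable sum are exchanged by monotone convergence;
    the integral of h_I^2 w is the mean of [w]. *)
Lemma L2norm_square_fun w f : measurable_fun setT w -> (forall x, 0 <= w x) ->
  (forall I, D I -> intg I w) ->
  L2norm w (square_fun D f) =
  sqrte (\esum_(I in D) (mean w I * inner f (haar I) ^+ 2)%:E).
Proof.
move=> mw w0 iw; have [e [P [PD eP sE]]] := square_fun_series.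
have mw0 I : D I -> 0 <= mean w I.
  by move=> DI; rewrite divr_ge0//; [exact: Rintegral_ge0|rewrite ltW// (len_gt0 hD)].
rewrite /L2norm eP; last by move=> I DI; rewrite lee_fin mulr_ge0 ?mw0// sqr_ge0.
congr sqrte.
have t0 n x : (0 <= if P n then (sq_term f (e n) x)%:E else 0)%E.
  by case: ifPn => // Pn; rewrite lee_fin; apply: sq_term_ge0; exact: PD.
transitivity (\int[mu]_x \sum_(n <oo) ((if P n then (sq_term f (e n) x)%:E else 0) * (w x)%:E))%E.
  apply: eq_integral => x _; rewrite gee0_abs; last by rewrite sE sqrte_ge0.
  rewrite sE sqr_sqrte; last by apply: nneseries_ge0 => n _ _; exact: t0.
  by rewrite muleC -nneseriesZl//; apply: eq_eseriesr => n _; rewrite muleC.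
rewrite integral_nneseries//; last 2 first.
- move=> n; case: (boolP (P n)) => Pn; last first.
    by under eq_fun do rewrite mul0e; exact: measurable_cst.
  under eq_fun do rewrite -EFinM.
  apply/measurable_EFinP; apply: measurable_funM => //.
  by apply: measurable_sq_term; exact: PD.
- by move=> n x _; rewrite mule_ge0// lee_fin.
apply: eq_eseriesr => n _; case: (boolP (P n)) => Pn; last first.
  by under eq_integral do rewrite mul0e; rewrite integral0.
have DI := PD n Pn; have mI := measurable_grid hD DI; move: (e n) DI mI => I DI mI.
have iI := iw I DI.
have E x : ((sq_term f I x)%:E * (w x)%:E = (inner f (haar I) ^+ 2 / len I)%:E * ((w \_ I) x)%:E)%E.
  rewrite -!EFinM /sq_term patchE indicE; case: ifP => _ /=; rewrite ?mul0r ?mulr0 ?mul0r ?mul1r -?mulrA //; congr EFin; ring.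
under eq_integral do rewrite E.
have ip := intg_patch mI iI.
rewrite integralZl//.
rewrite -[X in (_ * X)%E]fineK; last by apply: integrable_fin_num.
rewrite -EFinM -/(Rintegral _ _ _) -Rintegral_mkcond /mean -/(len I).
by congr EFin; ring.
Qed.

End SquareFunction.

(** * From the paraproduct with symbol w to the square function *)

Section Key.
Context {R : realType} {D : set (set R)} (hD : dyadic_grid D).
Implicit Types (I J K : set R) (x y : R) (f g b : R -> R).
Local Notation mu := (@lebesgue_measure R).
Local Notation intg I f := (mu.-integrable I (EFin \o f)).
Local Notation leaves := (leaves (D := D)).
Local Notation forest := (forest (D := D)).
Local Notation generation := (generation (D := D)).

Variables (w : R -> R) (w0 : forall x, 0 < w x) (wA : A2 D w).
Let we0 x : 0 <= w x. Proof. exact: ltW. Qed.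

Lemma A2_measurable : measurable_fun setT w. Proof. by case: wA => [[[]]]. Qed.
Let mw := A2_measurable.

Lemma A2_intg I : D I -> intg I w.
Proof. by case: wA => [[lw _] _]; exact: (locally_integrable_intg hD). Qed.

(** A positive function with zero integral would vanish almost everywhere on a
    set of positive measure. *)
Lemma A2_gt0 I : D I -> 0 < \int[mu]_(x in I) w x.
Proof.
move=> DI; have mI := measurable_grid hD DI.
rewrite lt_neqAle Rintegral_ge0 ?andbT//; apply/eqP => e.
have iw := A2_intg DI.
have h : (\int[mu]_(x in I) `|(w x)%:E| = 0)%E.
  under eq_integral do rewrite /= ger0_norm//.
  by rewrite -[LHS]fineK ?integrable_fin_num// -/(Rintegral _ _ _) -e.
have /(ae_eq_integral_abs mu mI) : measurable_fun I (EFin \o w).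
  by apply/measurable_EFinP; exact: measurable_funTS.
move=> [/(_ h) [N [mN N0 sub]] _].
have IN : I `<=` N by move=> x Ix; apply: sub => /= /(_ Ix) [] /eqP; rewrite gt_eqF.
have : (mu I <= 0)%E by rewrite -N0 le_measure// inE.
by rewrite (mu_len hD DI) lee_fin leNgt (len_gt0 hD).
Qed.

Lemma A2_mean_gt0 I : D I -> 0 < mean w I.
Proof. by move=> DI; rewrite divr_gt0// ?A2_gt0// (len_gt0 hD). Qed.

(** In the A_2 condition the first mean is positive, so the second is
    finite. *)
Lemma A2_intg_winv I : D I -> intg I (winv w).
Proof.
move=> DI; have l0 := len_gt0 hD DI; have mI := measurable_grid hD DI.
apply/integrableP; split.
  by apply/measurable_EFinP; apply: measurable_funTS; exact: measurable_winv.
under eq_integral do rewrite /= ger0_norm ?(ltW (winv_gt0 w0 _))//.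
have : (emean w I * emean (winv w) I < +oo)%E.
  by apply: le_lt_trans wA.2; apply: ereal_sup_ubound; exists I.
rewrite (emean_fin hD DI (A2_intg DI)) /emean (mu_len hD DI) inver gt_eqF//.
move=> h; rewrite ltey; apply: contraTN h => /eqP ->.
by rewrite gt0_mulye ?lte_fin ?invr_gt0// gt0_muley ?ltxx// lte_fin A2_mean_gt0.
Qed.

(** By [amgm_weight] with a = 1, both [w^-1] and [f^2 w] being integrable on
    [I]. *)
Lemma L2_intg f I : L2 w f -> D I -> intg I f.
Proof.
move=> /(L2P mw we0)[mf fi] DI; have mI := measurable_grid hD DI.
have le x : `|f x| <=
    2^-1 * (1^-1 * (1 ^+ 2 * winv w x) + 1 * (f x ^+ 2 * w x)).
  by rewrite -[in leLHS](mul1r (f x)); exact: amgm_weight.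
apply: (intg_le mI _ (fun x _ => le x)); first exact: measurable_funTS.
apply: intgZ => //; apply: intgD => //; apply: intgZ => //.
  by apply: intgZ => //; exact: A2_intg_winv.
by apply: integrableS fi.
Qed.

Section Pairing.
Variables (b f : R -> R) (Lf : L2 w f).

Lemma partial_seq (s : seq (set R)) x : uniq s ->
  paraproduct_partial [set` s] b f x =
  \sum_(I <- s) inner b (haar I) * mean f I * haar I x.
Proof. by move=> us; rewrite /paraproduct_partial -fsbig_seq. Qed.

Lemma pairing_partial (s : seq (set R)) : uniq s -> (forall I, I \in s -> D I) ->
  \int[mu]_x (paraproduct_partial [set` s] b f x * f x) =
  \sum_(I <- s) inner b (haar I) * mean f I * inner f (haar I).
Proof.
move=> us sD.
have iI I : I \in s -> intg setT (fun x => f x * haar I x).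
  by move=> /sD DI; apply: (intg_mul_haar hD DI); exact: (L2_intg Lf).
transitivity (\int[mu]_x \sum_(I <- s) inner b (haar I) * mean f I * (f x * haar I x)); last first.
  rewrite Rintegral_sum//; last by move=> I Is; apply: intgZ => //; exact: iI.
  by apply: eq_big_seq => I Is; rewrite RintegralZl//; exact: iI.
apply: eq_Rintegral => x _; rewrite partial_seq// big_distrl/=; apply: eq_bigr => I _.
by rewrite -[LHS]mulrA [haar I x * _]mulrC.
Qed.

Lemma measurable_partial (s : seq (set R)) : uniq s -> (forall I, I \in s -> D I) ->
  measurable_fun setT (paraproduct_partial [set` s] b f).
Proof.
move=> us sD.
rewrite (_ : paraproduct_partial _ _ _ =
  fun x => \sum_(I <- s) inner b (haar I) * mean f I * haar I x); last first.
  by apply/funext => x; exact: partial_seq.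
elim: s {us} sD => [|I s IH] sD.
  by under eq_fun do rewrite big_nil; exact: measurable_cst.
under eq_fun do rewrite big_cons.
apply: measurable_funD; last by apply: IH => J Js; apply: sD; rewrite in_cons Js orbT.
apply: measurable_funM => //; apply: (measurable_haar hD).
by apply: sD; rewrite mem_head.
Qed.

End Pairing.

Lemma sum_subseq (T : eqType) (s t : seq T) (F : T -> R) :
  uniq s -> uniq t -> {subset s <= t} -> (forall i, i \in t -> 0 <= F i) ->
  \sum_(i <- s) F i <= \sum_(i <- t) F i.
Proof.
move=> us ut st F0; rewrite [leRHS](bigID (fun i => i \in s))/=.
rewrite (perm_big [seq i <- t | i \in s]) /=; last first.
  apply: uniq_perm => //; first exact: filter_uniq.
  by move=> i; rewrite mem_filter /=; case: (boolP (i \in s)) => // /st ->.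
rewrite big_filter lerDl big_seq_cond sumr_ge0// => i /andP[it _]; exact: F0.
Qed.

(** The squared form of: the paraproduct with symbol [b] has norm at most [C]
    from L^2(w) to L^2(w^-1). *)
Definition paraproduct_le b C := forall f, L2 w f -> exists2 g,
  is_paraproduct D (winv w) b f g & energy (winv w) g <= C ^+ 2 * energy w f.

Lemma paraproduct_le_opnorm b C : 0 <= C ->
  (forall f, L2 w f -> exists2 g,
     [set EFin \o g | g in is_paraproduct D (winv w) b f] g &
     (L2norm (winv w) g <= C%:E * L2norm w (EFin \o f))%E) ->
  paraproduct_le b C.
Proof.
move=> C0 h f Lf; have [_ [g pg <-] hg] := h f Lf; exists g => //.
move: hg; rewrite (L2normE mw we0 Lf) -EFinM => hg.
have r0 : 0 <= C * Num.sqrt (energy w f) by rewrite mulr_ge0 ?sqrtr_ge0.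
have [mg _] := pg.1.
have [_] := L2norm_le (measurable_winv mw w0) (fun x => ltW (winv_gt0 w0 x)) mg r0 hg.
by rewrite exprMn sqr_sqrtr// energy_ge0.
Qed.

Section Symbol_w.
Variables (C : R) (C0 : 0 < C) (hC : paraproduct_le w C).

(** Once a finite family contains enough intervals, its partial sum is close
    in L^2(w^-1) to the value of the paraproduct, whose pairing with [f] is at
    most C ||f||^2. *)
Lemma forest_pairing_bound f (e : R) : 0 < e -> L2 w f -> exists F0 : seq (set R),
  (forall I, I \in F0 -> D I) /\
  forall s, uniq s -> (forall I, I \in s -> D I) -> {subset F0 <= s} ->
  `|\sum_(I <- s) inner w (haar I) * mean f I * inner f (haar I)| <=
  C * energy w f + e.
Proof.
move=> e0 Lf; have [g [Lg gP] hg] := hC Lf.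
have Q0 := energy_ge0 we0 f; set Q := energy w f in Q0 hg *.
(* chosen so that d (1 + Q) / 2 = e, the bound for the remainder below *)
pose d := 2 * e / (1 + Q).
have Q1 : 0 < 1 + Q by lra.
have d0 : 0 < d by rewrite divr_gt0// mulr_gt0.
have [F0 [finF0 F0D] F0P] := gP d d0.
move: finF0 F0D F0P => /finite_seqP[r ->] F0D F0P.
exists r; split => [//|s us sD F0s].
rewrite -pairing_partial//.
set p := paraproduct_partial _ _ _.
have mp : measurable_fun setT p by exact: measurable_partial.
have [mg _] := Lg.
have hgp : (L2norm (winv w) (EFin \o (fun x => g x - p x)%R) <= d%:E)%E.
  by apply: F0P; [exact: finite_seq|exact: F0s|exact: sD].
have mgp : measurable_fun setT (fun x => g x - p x) by exact: measurable_funB.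
have [Lgp hgp2] := L2norm_le (measurable_winv mw w0)
  (fun x => ltW (winv_gt0 w0 x)) mgp (ltW d0) hgp.
(* t = C balances the two halves for the limit, t = d for the remainder *)
have [i1 b1] := pairing_bound mw w0 C0 Lf Lg.
have [i2 b2] := pairing_bound mw w0 d0 Lf Lgp.
have -> : \int[mu]_x (p x * f x) = \int[mu]_x (g x * f x) - \int[mu]_x ((g x - p x) * f x).
  by rewrite -RintegralB//; apply: eq_Rintegral => x _; ring.
apply: (le_trans (ler_normB _ _)); apply: lerD.
  apply: (le_trans b1); rewrite -/Q.
  apply: (@le_trans _ _ (2^-1 * (C^-1 * (C ^+ 2 * Q) + C * Q))).
    by rewrite ler_pM2l// lerD2r ler_pM2l ?invr_gt0.
  by rewrite le_eqVlt; apply/orP; left; apply/eqP; field; rewrite gt_eqF.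
apply: (le_trans b2); rewrite -/Q.
apply: (@le_trans _ _ (2^-1 * (d^-1 * d ^+ 2 + d * Q))).
  by rewrite ler_pM2l// lerD2r ler_pM2l ?invr_gt0.
have -> : d^-1 * d ^+ 2 = d by field; rewrite gt_eqF.
have hd : d * (1 + Q) = 2 * e by rewrite /d divfK// gt_eqF.
lra.
Qed.

(** The forest is taken so large that it contains [F], that its leaves
    nearly give the integral of w f^2, and that [forest_pairing_bound]
    applies; in [sum_forest] the sum over the roots is nonnegative and is
    dropped. *)
Lemma square_sum_le_bounded f (M : R) (F : seq (set R)) :
  L2 w f -> (forall x, `|f x| <= M) -> uniq F -> (forall I, I \in F -> D I) ->
  \sum_(I <- F) mean w I * inner f (haar I) ^+ 2 <= (1 + 2 * C) * energy w f.
Proof.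
move=> Lf fM uF FD.
have [mf fi] := (L2P mw we0 f).1 Lf.
apply/ler_addgt0Pr => e e0.
pose d := e / 3; have d0 : 0 < d by rewrite divr_gt0.
have [F0 [F0D F0P]] := forest_pairing_bound d0 Lf.
have [k [s [ls [n0 n0P]]]] : exists k s, generation (2 ^ k) s /\
    exists n0, forall n, (n0 <= n)%N -> {subset F ++ F0 <= forest n s}.
  apply: (forest_exhausts hD) => J; rewrite mem_cat => /orP[/FD//|/F0D//].
have cv := leaves_cvg hD ls we0 mw A2_intg mf fM.
have lQ : \sum_(I <- s) \int[mu]_(x in I) (w x * f x ^+ 2) <= energy w f.
  have -> : energy w f = \int[mu]_x (w x * f x ^+ 2).
    by apply: eq_Rintegral => x _; rewrite mulrC.
  apply: (sum_generation_le hD ls) => [x|]; first by rewrite mulr_ge0// sqr_ge0.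
  by under eq_fun do rewrite mulrC.
set L := (X in X <= _) in lQ; rewrite -/L in cv.
have Ld : L < L + d by rewrite ltrDl.
have [n1 _ n1P] := cvgr_le _ cv _ Ld.
pose n := maxn n0 n1.
have hn := n1P n (leq_maxr n0 n1).
have sub := n0P n (leq_maxl n0 n1).
have [uf fD] := forest_spec hD n ls.
have iL I : I \in s -> D I by move=> /ls.2[].
have := sum_forest hD n ls (fun I Is => A2_intg (iL I Is)) (fun I Is => L2_intg Lf (iL I Is)).
have subF0 : {subset F0 <= forest n s}.
  by move=> I IF0; apply: sub; rewrite mem_cat IF0 orbT.
have B := F0P _ uf (fun I If => (fD I If).1) subF0.
move: hn => /= hn E.
apply: (@le_trans _ _ (\sum_(I <- forest n s) mean w I * inner f (haar I) ^+ 2)).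
  apply: sum_subseq => //; first by move=> I IF; apply: sub; rewrite mem_cat IF.
  by move=> I /fD[DI _]; rewrite mulr_ge0 ?sqr_ge0// ltW// A2_mean_gt0.
have T0 : 0 <= \sum_(I <- s) \int[mu]_(x in I) w x * mean f I ^+ 2.
  rewrite big_seq sumr_ge0// => I /iL DI.
  by rewrite mulr_ge0 ?sqr_ge0// ltW// A2_gt0.
move: B; rewrite ler_norml => /andP[B _].
rewrite E in hn; rewrite /d in hn B; lra.
Qed.

(** Truncating [f] does not increase its norm, and the finitely many Haar
    coefficients on the left converge. *)
Lemma square_sum_le f (F : seq (set R)) :
  L2 w f -> uniq F -> (forall I, I \in F -> D I) ->
  \sum_(I <- F) mean w I * inner f (haar I) ^+ 2 <= (1 + 2 * C) * energy w f.
Proof.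
move=> Lf uF FD.
have [mf fi] := (L2P mw we0 f).1 Lf.
pose B (n : nat) := [set x | `|f x| <= n%:R].
have mB n : measurable (B n).
  rewrite -[B n]setTI.
  have h : measurable_fun setT (fun x => `|f x|) by exact: measurableT_comp.
  rewrite (_ : _ `&` _ = setT `&` (fun x => `|f x|) @^-1` `]-oo, n%:R]%classic).
    by apply: h => //; exact: measurable_itv.
  by rewrite !setTI; apply/seteqP; split=> x; rewrite /B /= ?in_itv.
pose fn n x := f x * \1_(B n) x.
have fnf n x : `|fn n x| <= `|f x|.
  by rewrite /fn normrM -[leRHS]mulr1 ler_wpM2l// indicE; case: (_ \in _); rewrite ?normr1 ?normr0.
have fnn n x : `|fn n x| <= n%:R.
  rewrite /fn indicE; have [Bx|nBx] := pselect (B n x).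
    by rewrite mem_set// mulr1.
  by rewrite memNset// mulr0 normr0.
have mfn n : measurable_fun setT (fn n).
  by apply: measurable_funM => //; exact: measurable_indic.
have sq n x : fn n x ^+ 2 * w x <= f x ^+ 2 * w x.
  rewrite ler_wpM2r// -[leLHS]real_normK ?num_real// -[leRHS]real_normK ?num_real//.
  by rewrite lerXn2r ?nnegrE.
have Lfn n : L2 w (fn n).
  apply/(L2P mw we0); split => //.
  apply: (intg_le _ _ _ fi) => //; first exact: measurable_sqr_mul.
  by move=> x _; rewrite ger0_norm ?sq// mulr_ge0// sqr_ge0.
have Efn n : energy w (fn n) <= energy w f.
  by apply: le_Rintegral => //; exact: ((L2P mw we0 _).1 (Lfn n)).2.
have fcv x : fn n x @[n --> \oo] --> f x.
  apply: cvg_near_cst; exists (Num.bound `|f x|) => // n /= hn.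
  rewrite /fn indicE mem_set ?mulr1// /B /=.
  apply: (le_trans (ltW (archi_boundP (normr_ge0 (f x))))).
  by rewrite ler_nat.
have icv I : I \in F -> inner (fn n) (haar I) @[n --> \oo] --> inner f (haar I).
  move=> /FD DI; have mI := measurable_grid hD DI.
  have mh := measurable_haar hD DI.
  apply: (Rintegral_dominated (g := fun x => `|f x * haar I x|)) => //.
  - by move=> n; exact: measurable_funM.
  - exact: measurable_funM.
  - apply: aeW => x _; apply: cvgMr_tmp; exact: fcv.
  - by apply: integrable_norm; apply: (intg_mul_haar hD DI); exact: (L2_intg Lf).
  - by move=> n x _; rewrite [leLHS]normrM [leRHS]normrM; apply: ler_wpM2r.
have cv : \sum_(I <- F) mean w I * inner (fn n) (haar I) ^+ 2 @[n --> \oo] -->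
    \sum_(I <- F) mean w I * inner f (haar I) ^+ 2.
  move: icv; elim: (F) => [|I t IH] icv.
    by rewrite big_nil; under eq_fun do rewrite big_nil; exact: cvg_cst.
  rewrite big_cons (_ : (fun n => _) = fun n => mean w I * inner (fn n) (haar I) ^+ 2 +
    \sum_(J <- t) mean w J * inner (fn n) (haar J) ^+ 2); last first.
    by apply/funext => n; rewrite big_cons.
  apply: cvgD; last by apply: IH => J Jt; apply: icv; rewrite in_cons Jt orbT.
  have ci := icv I (mem_head _ _).
  by apply: cvgMl_tmp; under eq_fun do rewrite expr2; rewrite expr2; exact: cvgM.
apply: (cvgr_to_le cv); apply: nearW => n.
apply: (le_trans (square_sum_le_bounded (Lfn n) (fnn n) uF FD)).
by rewrite ler_wpM2l// addr_ge0// mulr_ge0// ltW.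
Qed.

Lemma square_fun_le f : L2 w f ->
  (L2norm w (square_fun D f) <=
   (Num.sqrt (1 + 2 * C))%:E * L2norm w (EFin \o f))%E.
Proof.
move=> Lf; have C1 : 0 <= 1 + 2 * C by rewrite addr_ge0// mulr_ge0// ltW.
rewrite (L2norm_square_fun hD f mw we0 A2_intg) (L2normE mw we0 Lf) -EFinM -sqrtrM//.
rewrite -[X in (_ <= X)%E]/(sqrte ((1 + 2 * C) * energy w f)%:E) lee_sqrt; last first.
  by rewrite lee_fin mulr_ge0// energy_ge0.
apply: ge_ereal_sup => _ [F [/finite_seqP[r ->] rD] <-].
rewrite (_ : [set` r] = [set` undup r]); last first.
  by apply/seteqP; split=> I; rewrite /= mem_undup.
rewrite -fsbig_seq ?undup_uniq// sumEFin lee_fin; apply: square_sum_le => //.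
  exact: undup_uniq.
by move=> I; rewrite mem_undup => /rD.
Qed.

End Symbol_w.

End Key.

(** * A symbol with a single Haar coefficient *)

Section TestSymbol.
Context {R : realType} {D : set (set R)} (hD : dyadic_grid D).
Implicit Types (I K : set R) (x y : R) (f g b : R -> R).
Local Notation mu := (@lebesgue_measure R).
Local Notation intg I f := (mu.-integrable I (EFin \o f)).
Local Notation lchild := (lchild (D := D)).
Local Notation rchild := (rchild (D := D)).

Lemma Rintegral_indic (K A : set R) : measurable K -> measurable A -> A `<=` K ->
  \int[mu]_(x in K) \1_A x = fine (mu A).
Proof. by move=> mK mA AK; rewrite /Rintegral integral_indic// setIidl. Qed.

Lemma Rintegral_eq_cst (K : set R) f c : measurable K ->
  (forall x, K x -> f x = c) -> \int[mu]_(x in K) f x = c * len K.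
Proof.
move=> mK fc; rewrite -Rintegral_cst//; apply: eq_Rintegral => x.
by rewrite inE; exact: fc.
Qed.

Lemma intg_indic (K A : set R) : measurable K -> measurable A -> (mu A < +oo)%E ->
  intg K (\1_A).
Proof.
move=> mK mA fA; apply/integrableP; split; first by apply/measurable_EFinP; exact: measurable_indic.
under eq_integral do rewrite /= ger0_norm//.
rewrite integral_indic//; apply: le_lt_trans fA.
by apply: le_measure; rewrite ?inE//; exact: measurableI.
Qed.

Variables (J : set R) (DJ : D J).
Let mJ : measurable J := measurable_grid hD DJ.
Let mL : measurable (lchild J) := measurable_grid hD (grid_lchild hD DJ).
Let mR : measurable (rchild J) := measurable_grid hD (grid_rchild hD DJ).

(** The Haar function of [J] times the square root of the length of [J], with
    halves taken in the grid. *)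
Definition haar_step x : R := \1_(rchild J) x - \1_(lchild J) x.

Lemma haar_step_l x : lchild J x -> haar_step x = -1.
Proof.
move=> Lx; rewrite /haar_step !indicE (mem_set Lx) memNset ?sub0r//.
by move=> Rx; exact: (children_disj hD DJ Lx Rx).
Qed.

Lemma haar_step_r x : rchild J x -> haar_step x = 1.
Proof.
move=> Rx; rewrite /haar_step !indicE (mem_set Rx) memNset ?subr0//.
by move=> Lx; exact: (children_disj hD DJ Lx Rx).
Qed.

Lemma haar_step_out x : ~ J x -> haar_step x = 0.
Proof.
move=> nJx; rewrite /haar_step !indicE !memNset ?subrr//.
  by move=> /(lchild_sub hD DJ).
by move=> /(rchild_sub hD DJ).
Qed.

Lemma norm_haar_step x : `|haar_step x| = \1_J x.
Proof.
rewrite indicE; have [Jx|nJx] := pselect (J x).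
  rewrite mem_set//; have [Lx|Rx] := children_cover hD DJ Jx.
    by rewrite haar_step_l// normrN1.
  by rewrite haar_step_r// normr1.
by rewrite haar_step_out// memNset// normr0.
Qed.

Lemma intg_haar_step K : measurable K -> intg K haar_step.
Proof.
by move=> mK; apply: intgB => //; apply: intg_indic => //; apply: (mu_grid_lty hD);
  [exact: grid_rchild|exact: grid_lchild].
Qed.

Lemma Rintegral_haar_step_sup K : measurable K -> J `<=` K ->
  \int[mu]_(x in K) haar_step x = 0.
Proof.
move=> mK JK; rewrite RintegralB//; last 2 first.
- by apply: intg_indic => //; apply: (mu_grid_lty hD); exact: grid_rchild.
- by apply: intg_indic => //; apply: (mu_grid_lty hD); exact: grid_lchild.
rewrite !Rintegral_indic//.
- by rewrite -/(len _) -/(len _) len_rchild// len_lchild// subrr.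
- by apply: subset_trans JK; exact: lchild_sub.
- by apply: subset_trans JK; exact: rchild_sub.
Qed.

(** Intervals that do not contain [J] lie inside a half of [J] or miss [J]. *)
Lemma haar_step_cases I : D I ->
  (exists c, forall x, I x -> haar_step x = c) \/ J `<=` I.
Proof.
move=> DI; have [[x [Ix Jx]]|nIJ] := pselect (exists x, I x /\ J x); last first.
  left; exists 0 => x Ix; apply: haar_step_out => Jx; apply: nIJ; by exists x.
have [IJ|JI] := leP (len I) (len J); last first.
  by right; apply: (grid_nested hD DJ DI Jx Ix); exact: ltW.
have sIJ := grid_nested hD DI DJ Ix Jx IJ.
have [->|nIJ] := pselect (I = J); first by right.
left; have [IL|IR] := grid_sub_child hD DJ DI sIJ nIJ.
  by exists (-1) => y /IL; exact: haar_step_l.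
by exists 1 => y /IR; exact: haar_step_r.
Qed.

Lemma inner_haar_step I : D I -> I <> J -> inner haar_step (haar I) = 0.
Proof.
move=> DI nIJ; have mI := measurable_grid hD DI.
have mLI := measurable_grid hD (grid_lchild hD DI).
have mRI := measurable_grid hD (grid_rchild hD DI).
rewrite (inner_haar hD)//; last exact: intg_haar_step.
have [[c cP]|JI] := haar_step_cases DI.
  rewrite !(@Rintegral_eq_cst _ _ c)//; last 2 first.
  - by move=> x /(lchild_sub hD DI); exact: cP.
  - by move=> x /(rchild_sub hD DI); exact: cP.
  by rewrite len_rchild// len_lchild// subrr mulr0.
have [JL|JR] := grid_sub_child hD DI DJ JI (nesym nIJ).
  rewrite (Rintegral_haar_step_sup mLI JL) (@Rintegral_eq_cst _ _ 0)//.
    by rewrite mul0r subrr mulr0.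
  move=> x Rx; apply: haar_step_out => /JL Lx; exact: (children_disj hD DI Lx Rx).
rewrite (Rintegral_haar_step_sup mRI JR) (@Rintegral_eq_cst _ _ 0)//.
  by rewrite mul0r subrr mulr0.
move=> x Lx; apply: haar_step_out => /JR Rx; exact: (children_disj hD DI Lx Rx).
Qed.

Lemma inner_haar_step_self : inner haar_step (haar J) = Num.sqrt (len J).
Proof.
have l0 := len_gt0 hD DJ.
rewrite (inner_haar hD)//; last exact: intg_haar_step.
rewrite (@Rintegral_eq_cst _ _ 1 mR); last exact: haar_step_r.
rewrite (@Rintegral_eq_cst _ _ (-1) mL); last exact: haar_step_l.
rewrite len_rchild// len_lchild//.
have s0 : Num.sqrt (len J) != 0 by rewrite gt_eqF// sqrtr_gt0.
by rewrite -[X in X / 2](sqr_sqrtr (ltW l0)); field.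
Qed.

Section BMO.
Variables (w : R -> R) (w0 : forall x, 0 < w x) (wA : A2 D w).

Lemma wmeas_fin I : D I -> wmeas w I = (\int[mu]_(x in I) w x)%:E.
Proof.
move=> DI; rewrite /wmeas /Rintegral fineK//.
by apply: integrable_fin_num; [exact: measurable_grid hD _ DI|exact: (A2_intg hD)].
Qed.

Lemma intg_sub_cst b I c : D I -> intg I b -> intg I (fun x => b x - c).
Proof.
move=> DI ib; have mI := measurable_grid hD DI.
by apply: intgB => //; exact: (intg_cst hD).
Qed.

Lemma oscillation_fin b I : D I -> intg I b ->
  ((\int[mu]_(x in I) `|b x - mean b I|%:E) / wmeas w I =
   ((\int[mu]_(x in I) `|b x - mean b I|)%R / (\int[mu]_(x in I) w x)%R)%:E)%E.
Proof.
move=> DI ib; have mI := measurable_grid hD DI.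
rewrite wmeas_fin// inver gt_eqF ?(A2_gt0 hD w0 wA DI)// EFinM; congr (_ * _)%E.
rewrite /Rintegral fineK//; apply: integrable_fin_num => //.
by apply: integrable_norm; exact: intg_sub_cst.
Qed.

Lemma bmo_norm_le b r : (forall I, D I -> intg I b) ->
  (forall I, D I -> \int[mu]_(x in I) `|b x - mean b I| <= r * \int[mu]_(x in I) w x) ->
  (bmo_norm D w b <= r%:E)%E.
Proof.
move=> ib h; apply: ge_ereal_sup => _ [I DI <-].
by rewrite oscillation_fin ?ib// lee_fin ler_pdivrMr ?(A2_gt0 hD w0 wA DI)// h.
Qed.

Lemma bmo_norm_ge b I : D I -> intg I b ->
  (((\int[mu]_(x in I) `|b x - mean b I|) / (\int[mu]_(x in I) w x))%:E <= bmo_norm D w b)%E.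
Proof.
by move=> DI ib; rewrite -oscillation_fin//; apply: ereal_sup_ubound; exists I.
Qed.

(** The oscillation vanishes unless [I] contains [J]; then it is the length of
    [J], and the quotient by w(I) is largest for I = J. *)
Lemma bmo_norm_haar_step :
  bmo_norm D w haar_step = (len J / \int[mu]_(x in J) w x)%:E.
Proof.
have WJ := A2_gt0 hD w0 wA DJ; have l0 := len_gt0 hD DJ.
have istep I : D I -> intg I haar_step.
  by move=> DI; apply: intg_haar_step; exact: (measurable_grid hD).
have osc I : D I -> J `<=` I -> \int[mu]_(x in I) `|haar_step x - mean haar_step I| = len J.
  move=> DI JI; have mI := measurable_grid hD DI.
  rewrite /mean Rintegral_haar_step_sup// mul0r.
  under eq_Rintegral do rewrite subr0 norm_haar_step.
  by rewrite Rintegral_indic.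
apply/eqP; rewrite eq_le; apply/andP; split; last first.
  by rewrite -(osc J DJ (@subset_refl _ J)); apply: bmo_norm_ge => //; exact: istep.
apply: bmo_norm_le => // I DI; have mI := measurable_grid hD DI.
have lI := len_gt0 hD DI; have WI := A2_gt0 hD w0 wA DI.
have [[c cP]|JI] := haar_step_cases DI.
  rewrite (@Rintegral_eq_cst _ _ 0) => [|//|x Ix].
    by rewrite mul0r mulr_ge0 ?divr_ge0// ltW.
  by rewrite /mean (Rintegral_eq_cst mI cP) mulfK ?gt_eqF// cP// subrr normr0.
rewrite osc// mulrAC ler_pdivlMr// ler_pM2l//.
rewrite Rintegral_mkcond [leRHS]Rintegral_mkcond; apply: le_Rintegral => //.
- by apply: intg_patch => //; exact: (A2_intg hD).
- by apply: intg_patch => //; exact: (A2_intg hD).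
- move=> x _; rewrite !patchE; case: ifPn => [|_]; last by case: ifP => // _; exact: ltW.
  by rewrite inE => /JI /mem_set ->.
Qed.

Lemma BMO_haar_step : BMO D w haar_step /\ bmo_norm D w haar_step != 0.
Proof.
have WJ := A2_gt0 hD w0 wA DJ; have l0 := len_gt0 hD DJ.
split; last by rewrite bmo_norm_haar_step eqe gt_eqF// divr_gt0.
split; last by rewrite bmo_norm_haar_step ltry.
apply: (@locally_integrable_bounded _ _ 1).
  by apply: measurable_funB; exact: measurable_indic.
by move=> x; rewrite norm_haar_step indicE; case: (_ \in _).
Qed.

Lemma mean_indic_self : mean \1_J J = 1.
Proof.
rewrite /mean Rintegral_indic// divff//.
by rewrite -/(len J) gt_eqF// (len_gt0 hD).
Qed.

Lemma energy_indic : L2 w \1_J /\ energy w \1_J = \int[mu]_(x in J) w x.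
Proof.
have E x : \1_J x ^+ 2 * w x = (w \_ J) x.
  by rewrite patchE indicE; case: ifP => _; rewrite ?expr1n ?mul1r// expr0n mul0r.
split; last first.
  by rewrite /energy; under eq_Rintegral do rewrite E; rewrite -Rintegral_mkcond.
apply/(L2P (A2_measurable wA) (fun x => ltW (w0 x))); split; first exact: measurable_indic.
by under eq_fun do rewrite E; apply: intg_patch => //; exact: (A2_intg hD).
Qed.

(** The Cauchy-Schwarz inequality for the square roots of [w] and [w^-1]. *)
Lemma sqr_len_le_weights :
  len J ^+ 2 <= \int[mu]_(x in J) winv w x * \int[mu]_(x in J) w x.
Proof.
have WJ := A2_gt0 hD w0 wA DJ; have l0 := len_gt0 hD DJ.
have iw := A2_intg hD wA DJ; have iv := A2_intg_winv hD w0 wA DJ.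
set W := \int[mu]_(x in J) w x in WJ *; set S := \int[mu]_(x in J) winv w x.
(* the integral of t w over J is then len J *)
pose t := len J / W; have t0 : 0 < t by rewrite divr_gt0.
have : \int[mu]_(x in J) 1 <= \int[mu]_(x in J) (2^-1 * (t^-1 * winv w x + t * w x)).
  apply: le_Rintegral => //.
  - exact: (intg_cst hD).
  - by apply: intgZ => //; apply: intgD => //; exact: intgZ.
  - move=> x _; have := @amgm_weight _ t 1 1 (w x) t0 (w0 x).
    by rewrite !mul1r normr1 expr1n !mul1r.
rewrite Rintegral_cst// mul1r -/(len J) RintegralZl//; last by apply: intgD => //; exact: intgZ.
rewrite RintegralD//; [|exact: intgZ|exact: intgZ].
rewrite !RintegralZl// -/W -/S => h.
have tW : t * W = len J by rewrite /t divfK// gt_eqF.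
have h2 : len J <= t^-1 * S by lra.
have : len J * t <= S by rewrite -ler_pdivlMr// mulrC.
rewrite /t mulrA ler_pdivrMr// => h3; lra.
Qed.

(** The paraproduct sends the indicator of [J] to a function of modulus 1 on
    [J] and 0 elsewhere, so C^2 w(J) is at least w^-1(J), up to the factor 2
    lost in comparing the limit with a partial sum; [sqr_len_le_weights] then bounds
    w^-1(J) from below. *)
Lemma paraproduct_le_haar_step C : 0 <= C -> paraproduct_le (D := D) w haar_step C ->
  2^-1 * (len J / \int[mu]_(x in J) w x) <= C.
Proof.
move=> C0 dom; have WJ := A2_gt0 hD w0 wA DJ; have l0 := len_gt0 hD DJ.
have mw := A2_measurable wA; have ms := measurable_winv mw w0.
have s0 x : 0 <= winv w x by rewrite ltW// winv_gt0.
have [L1 E1] := energy_indic; have [g [Lg gP]] := dom _ L1.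
rewrite E1; have CS := sqr_len_le_weights.
set W := \int[mu]_(x in J) w x in WJ CS *.
set S := \int[mu]_(x in J) winv w x in CS * => hg.
have [mg ig] := (L2P ms s0 g).1 Lg.
have S_le : S <= 2 * (C ^+ 2 * W).
  apply/ler_addgt0Pr => e e0.
  pose d := Num.sqrt (e / 2).
  have d0 : 0 < d by rewrite sqrtr_gt0 divr_gt0.
  have [F0 [finF0 F0D] F0P] := gP d d0.
  move: finF0 F0D F0P => /finite_seqP[r ->] F0D F0P.
  pose s := undup (J :: r).
  have us : uniq s by exact: undup_uniq.
  have sD I : I \in s -> D I.
    by rewrite mem_undup in_cons => /predU1P[->//|/F0D].
  have hgp : (L2norm (winv w) (EFin \o (fun x => g x - paraproduct_partial [set` s] haar_step \1_J x)%R) <= d%:E)%E.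
    apply: F0P; [exact: finite_seq| |exact: sD].
    by move=> I Ir; rewrite /= mem_undup in_cons Ir orbT.
  set p := paraproduct_partial _ _ _ in hgp.
  have mp : measurable_fun setT p by exact: (measurable_partial hD).
  have mgp : measurable_fun setT (fun x => g x - p x) by exact: measurable_funB.
  have [Lgp] := L2norm_le ms s0 mgp (ltW d0) hgp.
  rewrite /d sqr_sqrtr ?divr_ge0 ?(ltW e0)// => hgp2.
  have [_ igp] := (L2P ms s0 _).1 Lgp.
  have pE x : p x = Num.sqrt (len J) * haar J x.
    rewrite /p partial_seq// (bigD1_seq J)//=; last by rewrite mem_undup mem_head.
    rewrite big1_seq ?addr0 => [|I /andP[/eqP nIJ Is]].
      by rewrite inner_haar_step_self mean_indic_self mulr1.
    by rewrite inner_haar_step ?mul0r//; exact: sD.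
  have SE : S = \int[mu]_x (p x ^+ 2 * winv w x).
    rewrite /S Rintegral_mkcond; apply: eq_Rintegral => x _.
    rewrite pE exprMn (haar_sqr hD)// sqr_sqrtr ?(ltW l0)// patchE indicE.
    by case: ifP => _; rewrite ?mul0r ?mulr0 ?mul0r// mul1r mulfV ?mul1r// gt_eqF.
  have ip : intg setT (fun x => 2 * (g x ^+ 2 * winv w x) + 2 * ((g x - p x) ^+ 2 * winv w x)).
    by apply: intgD => //; exact: intgZ.
  have le2 x : p x ^+ 2 * winv w x <= 2 * (g x ^+ 2 * winv w x) + 2 * ((g x - p x) ^+ 2 * winv w x).
    rewrite !mulrA -mulrDl ler_wpM2r// -subr_ge0.
    rewrite (_ : _ - _ = (2 * g x - p x) ^+ 2); last by ring.
    exact: sqr_ge0.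
  rewrite SE; apply: (@le_trans _ _ (2 * energy (winv w) g + 2 * energy (winv w) (fun x => g x - p x))).
    rewrite /energy -!RintegralZl// -RintegralD//; try exact: intgZ.
    apply: le_Rintegral => //.
    apply: (intg_le _ _ _ ip) => //; first exact: measurable_sqr_mul.
    by move=> x _; rewrite ger0_norm ?le2// mulr_ge0// sqr_ge0.
  by lra.
have : len J <= 2 * (C * W).
  rewrite -(@ler_pXn2r _ 2)// ?nnegrE ?mulr_ge0 ?(ltW l0) ?(ltW WJ)//.
  apply: (le_trans CS); apply: (@le_trans _ _ (2 * (C ^+ 2 * W) * W)).
    by rewrite ler_pM2r.
  rewrite -subr_ge0 (_ : _ - _ = 2 * (C * W) ^+ 2); last by ring.
  by rewrite mulr_ge0// sqr_ge0.
by rewrite ler_pdivrMl// ler_pdivrMr// -mulrA.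
Qed.

End BMO.
End TestSymbol.

(** * The lower bound for weights that are positive everywhere *)

Section LowerBound.
Context {R : realType} {D : set (set R)} (hD : dyadic_grid D).
Implicit Types (I J K : set R) (x y : R) (f g b : R -> R).
Local Notation mu := (@lebesgue_measure R).
Local Notation intg I f := (mu.-integrable I (EFin \o f)).
Local Notation paraproduct_le := (paraproduct_le (D := D)).
Local Notation lchild := (lchild (D := D)).
Local Notation rchild := (rchild (D := D)).

Lemma opnorm_ge0 (u v : R -> R) T : (0 <= opnorm u v T)%E.
Proof. by apply: le_ereal_inf_tmp => _ [C [C0 _] <-]; rewrite lee_fin. Qed.

Section Positive.
Variables (w : R -> R) (w0 : forall x, 0 < w x) (wA : A2 D w).
Let we0 x : 0 <= w x. Proof. exact: ltW. Qed.
Let mw := A2_measurable wA.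
Let iw := A2_intg hD wA.

Lemma paraproduct_norm_ge b r :
  (forall C, 0 <= C -> paraproduct_le w b C -> r <= C) ->
  (r%:E <= paraproduct_norm D w b)%E.
Proof.
move=> h; apply: le_ereal_inf_tmp => _ [C [C0 hC] <-]; rewrite lee_fin; apply: h => //.
exact: paraproduct_le_opnorm.
Qed.

Lemma paraproduct_norm_lt b r : (paraproduct_norm D w b < r%:E)%E ->
  exists2 C, 0 <= C < r & paraproduct_le w b C.
Proof.
move=> /ereal_inf_lt[_ [C [C0 hC] <-]]; rewrite lte_fin => Cr.
exists C; first by rewrite C0.
exact: paraproduct_le_opnorm.
Qed.

Lemma paraproduct_leW b C C' : 0 <= C <= C' -> paraproduct_le w b C -> paraproduct_le w b C'.
Proof.
move=> /andP[C0 CC'] h f /h[g pg hg]; exists g => //; apply: (le_trans hg).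
by rewrite ler_wpM2r ?energy_ge0// lerXn2r// nnegrE// (le_trans C0).
Qed.

Lemma bmo_norm_weight : (bmo_norm D w w <= 2%:E)%E.
Proof.
apply: bmo_norm_le => // I DI; have mI := measurable_grid hD DI.
have iI := iw DI; have l0 := len_gt0 hD DI.
have m0 : 0 < mean w I by exact: (A2_mean_gt0 hD).
have ic := intg_cst hD (mean w I) DI.
apply: (@le_trans _ _ (\int[mu]_(x in I) (w x + mean w I))).
  apply: le_Rintegral => //.
  - by apply: integrable_norm; exact: (intg_sub_cst hD).
  - exact: intgD.
  - by move=> x _; rewrite (le_trans (ler_normB _ _))// !gtr0_norm.
rewrite RintegralD// Rintegral_cst// /mean divfK; first by rewrite mulr_natl mulr2n.
by rewrite -/(len I) gt_eqF.
Qed.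

(** The Haar coefficient is controlled by the oscillation on [I]. This is
    applied to b = w: a weight of zero norm in BMO(w) cannot be used as a
    symbol in the supremum, but its paraproduct vanishes. *)
Lemma bmo_norm_eq0_inner b I : (forall I, D I -> intg I b) -> bmo_norm D w b = 0%E ->
  D I -> inner b (haar I) = 0.
Proof.
move=> ib b0 DI; have mI := measurable_grid hD DI; have l0 := len_gt0 hD DI.
have WI := A2_gt0 hD w0 wA DI.
have := bmo_norm_ge hD w0 wA DI (ib I DI).
rewrite b0 lee_fin pmulr_lle0 ?invr_gt0// => o0.
have iI := ib I DI.
have im := intg_sub_cst hD (mean b I) DI iI.
have ia : intg I (fun x => `|b x - mean b I|) by exact: (integrable_norm im).
have mLI := measurable_grid hD (grid_lchild hD DI).
have mRI := measurable_grid hD (grid_rchild hD DI).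
have [aL aR] := intg_children hD DI ia; have [sL sR] := intg_children hD DI im.
have [bL bR] := intg_children hD DI iI.
have cst K : D K -> intg K b -> \int[mu]_(x in K) (b x - mean b I) =
    \int[mu]_(x in K) b x - mean b I * len K.
  move=> DK bK; rewrite RintegralB//.
  - by rewrite Rintegral_cst//; exact: (measurable_grid hD).
  - exact: (measurable_grid hD).
  - exact: (intg_cst hD).
rewrite (inner_haar hD)//.
have hL := @le_normr_Rintegral _ _ _ mu _ _ mLI sL.
have hR := @le_normr_Rintegral _ _ _ mu _ _ mRI sR.
have DL := grid_lchild hD DI; have DR := grid_rchild hD DI.
move: hL hR; rewrite !cst//.
rewrite (len_lchild hD)// (len_rchild hD)//.
rewrite (Rintegral_children hD DI ia) in o0.
move=> hL hR.
suff -> : \int[mu]_(x in rchild I) b x = \int[mu]_(x in lchild I) b x by rewrite subrr mulr0.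
move: hL hR o0.
set Br := \int[mu]_(x in rchild I) b x; set Bl := \int[mu]_(x in lchild I) b x.
set ol := \int[mu]_(x in lchild I) _; set or := \int[mu]_(x in rchild I) _.
set c := mean b I * _; move: Br Bl ol or c => Br Bl ol or c.
rewrite !ler_norml => /andP[h1 h2] /andP[h3 h4] h5; lra.
Qed.

Lemma paraproduct_le_bmo0 C : 0 <= C -> bmo_norm D w w = 0%E -> paraproduct_le w w C.
Proof.
move=> C0 b0 f Lf; exists (fun=> 0); last first.
  rewrite /energy; under eq_Rintegral do rewrite expr0n mul0r.
  by rewrite Rintegral_cst// mul0r mulr_ge0 ?sqr_ge0 ?energy_ge0.
have L0 : L2norm (winv w) (EFin \o (fun=> 0 : R)) = 0%E.
  rewrite L2norm_EFin; under eq_integral do rewrite expr0n mul0r.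
  by rewrite integral0 sqrte0.
split; first by split => //; rewrite L0.
move=> e e0; exists set0; first by split; [exact: finite_set0|exact: sub0set].
move=> F _ _ FD; rewrite (_ : (fun x => _) = EFin \o (fun=> 0)).
  by rewrite L0 lee_fin ltW.
apply/funext => x /=; congr EFin; rewrite sub0r /paraproduct_partial fsbig1 ?oppr0//.
by move=> I /FD DI; rewrite (bmo_norm_eq0_inner iw b0 DI) !mul0r.
Qed.

Lemma square_fun_norm_le C : 0 < C -> paraproduct_le w w C ->
  (square_fun_norm D w <= (Num.sqrt (1 + 2 * C))%:E)%E.
Proof.
move=> C0 hC; apply: ereal_inf_lbound; exists (Num.sqrt (1 + 2 * C)) => //; split.
  exact: sqrtr_ge0.
move=> f Lf; exists (square_fun D f) => //.
exact: (square_fun_le hD w0 wA C0 hC).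
Qed.

(** With r the supremum, r >= 1/2 by the symbol [haar_step], and the norm of
    the paraproduct with symbol [w] is at most 2 r because [w] has norm at most
    2 in BMO(w). Hence ||S||^2 <= 1 + 4 r <= 6 r. *)
Lemma lower_bound_pos :
  (6^-1%:E * square_fun_norm D w ^+ 2 <=
      ereal_sup [set paraproduct_norm D w b / bmo_norm D w b
                | b in [set b | BMO D w b /\ bmo_norm D w b != 0]])%E.
Proof.
set r := ereal_sup _.
have ub b : BMO D w b -> bmo_norm D w b != 0%E ->
    (paraproduct_norm D w b / bmo_norm D w b <= r)%E.
  by move=> Bb b0; apply: ereal_sup_ubound; exists b.
have [J [DJ _ _]] := grid_cover hD 0 0.
have r_half : (2^-1%:E <= r)%E.
  have [Bs s0] := BMO_haar_step hD DJ w0 wA.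
  apply: le_trans (ub _ Bs s0).
  have WJ := A2_gt0 hD w0 wA DJ; have l0 := len_gt0 hD DJ.
  have b0 : 0 < len J / \int[mu]_(x in J) w x by rewrite divr_gt0.
  rewrite (bmo_norm_haar_step hD DJ w0 wA) inver gt_eqF// lee_pdivlMr//.
  apply: paraproduct_norm_ge => C C0 hC.
  exact: (paraproduct_le_haar_step hD DJ w0 wA C0 hC).
have [ry|ry] := eqVneq r +oo%E; first by rewrite ry leey.
have rfin : r \is a fin_num.
  rewrite fin_numE ry andbT gt_eqF//; apply: lt_le_trans r_half; exact: ltNyr.
have [rho rE] : exists rho, r = rho%:E by exists (fine r); rewrite fineK.
rewrite rE lee_fin in r_half *.
have Bw : BMO D w w.
  split; first by case: wA => [[]].
  by apply: le_lt_trans bmo_norm_weight _; rewrite ltry.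
have exC e : 0 < e -> exists2 C, 0 < C <= 2 * rho + 2 * e & paraproduct_le w w C.
  move=> e0; have [b0|b0] := eqVneq (bmo_norm D w w) 0%E.
    exists e; first by rewrite e0/=; lra.
    by apply: paraproduct_le_bmo0 => //; exact: ltW.
  have bge : (0 <= bmo_norm D w w)%E.
    apply: le_trans (bmo_norm_ge hD w0 wA DJ (iw DJ)).
    rewrite lee_fin divr_ge0//; last by rewrite ltW// (A2_gt0 hD).
    exact: Rintegral_ge0.
  have bfin : bmo_norm D w w \is a fin_num.
    by rewrite ge0_fin_numE//; apply: le_lt_trans bmo_norm_weight _; rewrite ltry.
  have [bt btE] : exists bt, bmo_norm D w w = bt%:E by exists (fine (bmo_norm D w w)); rewrite fineK.
  have := ub w Bw b0; have := bmo_norm_weight.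
  rewrite btE lee_fin => bt2.
  have bt0 : 0 < bt.
    by rewrite lt_neqAle -lee_fin -btE bge andbT eq_sym -eqe -btE.
  rewrite inver gt_eqF// lee_pdivrMr// rE -EFinM => pn.
  have : (paraproduct_norm D w w < (2 * rho + e)%:E)%E.
    apply: (le_lt_trans pn); rewrite lte_fin.
    have : rho * bt <= rho * 2 by rewrite ler_wpM2l//; lra.
    by lra.
  move=> /paraproduct_norm_lt[C /andP[C0 Ce] hC]; exists (C + e); first by lra.
  by apply: paraproduct_leW hC; lra.
have [C1 /andP[C10 _] hC1] := exC 1 ltr01.
have Sfin : square_fun_norm D w \is a fin_num.
  rewrite ge0_fin_numE ?opnorm_ge0//.
  by apply: le_lt_trans (square_fun_norm_le C10 hC1) _; rewrite ltry.
have [s sE] : exists s, square_fun_norm D w = s%:E by exists (fine (square_fun_norm D w)); rewrite fineK.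
have s0 : 0 <= s by rewrite -lee_fin -sE opnorm_ge0.
rewrite sE -EFin_expe -EFinM lee_fin.
suff : s ^+ 2 <= 1 + 4 * rho by lra.
apply/ler_addgt0Pr => e e0.
have e4 : 0 < e / 4 by rewrite divr_gt0.
have [C /andP[C0 Ce] hC] := exC _ e4.
have := square_fun_norm_le C0 hC; rewrite sE lee_fin => h.
have C2 : 0 <= 1 + 2 * C by lra.
have : s ^+ 2 <= 1 + 2 * C.
  by rewrite -(sqr_sqrtr C2) lerXn2r// nnegrE sqrtr_ge0.
by lra.
Qed.

End Positive.

End LowerBound.

(** * The lower bound for all weights *)

Section Transport.
Context {R : realType} {D : set (set R)} (hD : dyadic_grid D).
Local Notation mu := (@lebesgue_measure R).

Lemma opnorm_eq (u v u' v' : R -> R) (T : (R -> R) -> set (R -> \bar R)) :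
  (forall F, measurable_fun setT F -> L2norm u F = L2norm u' F) ->
  (forall F, measurable_fun setT F -> L2norm v F = L2norm v' F) ->
  (forall f g, T f g -> measurable_fun setT g) ->
  opnorm u v T = opnorm u' v' T.
Proof.
move=> uE vE mT; congr ereal_inf; congr image.
have uf f : measurable_fun setT f -> L2norm u (EFin \o f) = L2norm u' (EFin \o f).
  by move=> mf; apply: uE; exact/measurable_EFinP.
have L2E f : L2 u f <-> L2 u' f by split=> -[mf]; split => //; rewrite (uf, =^~ uf).
apply/seteqP; split=> C [C0 h]; split => // f Lf; have mf := Lf.1.
  have /L2E/h[g Tg hg] := Lf; exists g => //.
  by rewrite -vE -?uf//; exact: mT Tg.
have /L2E/h[g Tg hg] := Lf; exists g => //.
by rewrite vE ?uf//; exact: mT Tg.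
Qed.

Lemma is_paraproduct_eq (u u' : R -> R) b f g :
  (forall F, measurable_fun setT F -> L2norm u F = L2norm u' F) ->
  is_paraproduct D u b f g -> is_paraproduct D u' b f g.
Proof.
move=> uE [[mg ug] h]; split.
  by split => //; rewrite -uE//; exact/measurable_EFinP.
move=> e /h[F0 F0P F0h]; exists F0 => // F finF F0F FD; rewrite -uE ?F0h//.
apply/measurable_EFinP; apply: measurable_funB => //.
move: finF FD => /finite_seqP[r ->] rD.
rewrite (_ : [set` r] = [set` undup r]); last first.
  by apply/seteqP; split=> I; rewrite /= mem_undup.
apply: (measurable_partial hD); first exact: undup_uniq.
by move=> I; rewrite mem_undup => /rD.
Qed.

Variables (w : R -> R) (wA : A2 D w).
Let mw : measurable_fun setT w := A2_measurable wA.

(** A function equal to [w] almost everywhere and positive at every point, so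
    that the lemmas above need no exceptional sets. *)
Definition pos_version (x : R) : R := `|w x| + \1_[set x | w x = 0] x.

Lemma pos_version_gt0 x : 0 < pos_version x.
Proof.
rewrite /pos_version indicE; have [wx|wx] := eqVneq (w x) 0.
  by rewrite mem_set// ltr_wpDl.
by rewrite memNset ?addr0 ?normr_gt0//; apply/eqP.
Qed.

Lemma measurable_pos_version : measurable_fun setT pos_version.
Proof.
apply: measurable_funD; first exact: measurableT_comp.
apply: measurable_indic; rewrite -[X in measurable X]setTI.
have -> : [set x | w x = 0] = w @^-1` [set 0] by [].
by apply: mw => //; exact: measurable_set1.
Qed.

Lemma pos_version_ae : exists N, [/\ measurable N, mu N = 0 & forall x, ~ N x -> w x = pos_version x].
Proof.
case: wA => [[_ [N [mN N0 sub]]] _]; exists N; split => // x nNx.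
have w0 : 0 < w x by apply: contrapT => h; apply: nNx; exact: sub.
by rewrite /pos_version gtr0_norm// indicE memNset ?addr0// => /= e; rewrite e ltxx in w0.
Qed.

Lemma integral_pos_version (H : R -> R -> \bar R) A : measurable A ->
  measurable_fun A (fun x => H x (w x)) -> measurable_fun A (fun x => H x (pos_version x)) ->
  (\int[mu]_(x in A) H x (w x) = \int[mu]_(x in A) H x (pos_version x))%E.
Proof.
move=> mA m1 m2; apply: ae_eq_integral => //.
have [N [mN N0 NE]] := pos_version_ae; exists N; split => // x /= h.
by apply: contrapT => /NE e; apply: h => _; rewrite e.
Qed.

Lemma L2norm_pos_version F : measurable_fun setT F -> L2norm w F = L2norm pos_version F.
Proof.
move=> mF; congr sqrte.
have h (v : R -> R) : measurable_fun setT v ->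
    measurable_fun setT (fun x => (`|F x| ^+ 2 * (v x)%:E)%E).
  move=> mv; apply: emeasurable_funM; last exact/measurable_EFinP.
  by under eq_fun do rewrite expe2; apply: emeasurable_funM; exact: measurableT_comp.
by apply: (integral_pos_version (H := fun x r => (`|F x| ^+ 2 * r%:E)%E)) => //; apply: h => //;
  exact: measurable_pos_version.
Qed.

Let mp := measurable_pos_version.

(** Here [w] may vanish; the inverse is [w] times the inverse of a positive
    function that equals [w^2] where [w] is not 0. *)
Lemma measurable_inv_weight : measurable_fun setT (winv w).
Proof.
pose v x := w x ^+ 2 + \1_[set x | w x = 0] x.
have v0 x : 0 < v x.
  rewrite /v indicE; have [wx|wx] := eqVneq (w x) 0.
    by rewrite mem_set// ltr_wpDl// sqr_ge0.
  by rewrite memNset ?addr0; [rewrite exprn_even_gt0|exact/eqP].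
have mv : measurable_fun setT v.
  apply: measurable_funD; first exact: measurable_funX.
  apply: measurable_indic; rewrite -[X in measurable X]setTI.
  have -> : [set x | w x = 0] = w @^-1` [set 0] by [].
  by apply: mw => //; exact: measurable_set1.
rewrite (_ : winv w = fun x => w x * winv v x).
  by apply: measurable_funM => //; exact: measurable_winv.
apply/funext => x; rewrite /winv /v indicE; have [wx|wx] := eqVneq (w x) 0.
  by rewrite wx invr0 mul0r.
by rewrite memNset ?addr0; [rewrite expr2 invfM mulVKf|exact/eqP].
Qed.

Let miv := measurable_inv_weight.
Let mip : measurable_fun setT (winv pos_version) := measurable_winv mp pos_version_gt0.

Lemma L2norm_winv_pos_version F : measurable_fun setT F ->
  L2norm (winv w) F = L2norm (winv pos_version) F.
Proof.
move=> mF; congr sqrte.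
have h (v : R -> R) : measurable_fun setT v ->
    measurable_fun setT (fun x => (`|F x| ^+ 2 * (v x)%:E)%E).
  move=> mv; apply: emeasurable_funM; last exact/measurable_EFinP.
  by under eq_fun do rewrite expe2; apply: emeasurable_funM; exact: measurableT_comp.
by apply: (integral_pos_version (H := fun x r => (`|F x| ^+ 2 * (r^-1)%:E)%E)) => //; exact: h.
Qed.

Lemma wmeas_pos_version I : measurable I -> wmeas w I = wmeas pos_version I.
Proof.
move=> mI; apply: (integral_pos_version (H := fun x r => r%:E)) => //;
  by apply/measurable_EFinP; exact: measurable_funTS.
Qed.

Lemma emean_pos_version I : measurable I -> emean w I = emean pos_version I.
Proof. by move=> mI; rewrite /emean -!/(wmeas _ _) wmeas_pos_version. Qed.

Lemma emean_winv_pos_version I : measurable I -> emean (winv w) I = emean (winv pos_version) I.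
Proof.
move=> mI; congr (_ / _)%E; apply: (integral_pos_version (H := fun x r => (r^-1)%:E)) => //.
  by apply/measurable_EFinP; exact: measurable_funTS miv.
by apply/measurable_EFinP; exact: measurable_funTS mip.
Qed.

Lemma A2const_pos_version : A2const D w = A2const D pos_version.
Proof.
congr ereal_sup; apply: eq_imagel => I DI; have mI := measurable_grid hD DI.
by rewrite emean_pos_version// emean_winv_pos_version.
Qed.

Lemma A2_pos_version : A2 D pos_version.
Proof.
split; last by rewrite -A2const_pos_version; case: wA.
split; last by apply: aeW => x; exact: pos_version_gt0.
case: wA => [[[_ oT wK] _] _]; split => // K KT cK; have mK := compact_measurable cK.
rewrite -(integral_pos_version (H := fun x r => `|r|%:E)%E) ?wK//.
  by apply/measurable_EFinP; apply: measurableT_comp => //; exact: measurable_funTS.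
by apply/measurable_EFinP; apply: measurableT_comp => //; exact: measurable_funTS.
Qed.

Lemma bmo_norm_pos_version b : bmo_norm D w b = bmo_norm D pos_version b.
Proof.
congr ereal_sup; apply: eq_imagel => I DI; have mI := measurable_grid hD DI.
by rewrite wmeas_pos_version.
Qed.

Lemma square_fun_norm_pos_version : square_fun_norm D w = square_fun_norm D pos_version.
Proof.
apply: opnorm_eq; [exact: L2norm_pos_version|exact: L2norm_pos_version|].
by move=> f _ ->; exact: (measurable_square_fun hD).
Qed.

Lemma paraproduct_norm_pos_version b : paraproduct_norm D w b = paraproduct_norm D pos_version b.
Proof.
rewrite /paraproduct_norm (_ : (fun f => _) =
    fun f => [set EFin \o g | g in is_paraproduct D (winv pos_version) b f]).
  apply: opnorm_eq; [exact: L2norm_pos_version|exact: L2norm_winv_pos_version|].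
  by move=> f _ [g [[mg _] _] <-]; exact/measurable_EFinP.
apply/funext => f; congr image; apply/seteqP.
split=> g; first exact: (is_paraproduct_eq L2norm_winv_pos_version).
by apply: is_paraproduct_eq => F mF; rewrite L2norm_winv_pos_version.
Qed.

Lemma lower_bound :
  (6^-1%:E * square_fun_norm D w ^+ 2 <=
      ereal_sup [set paraproduct_norm D w b / bmo_norm D w b
                | b in [set b | BMO D w b /\ bmo_norm D w b != 0]])%E.
Proof.
rewrite square_fun_norm_pos_version (_ : [set _ | b in _] =
  [set paraproduct_norm D pos_version b / bmo_norm D pos_version b
    | b in [set b | BMO D pos_version b /\ bmo_norm D pos_version b != 0]])%E.
  exact: (lower_bound_pos hD pos_version_gt0 A2_pos_version).
rewrite (_ : [set b | _] = [set b | BMO D pos_version b /\ bmo_norm D pos_version b != 0%E]).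
  by apply: eq_imagel => b _; rewrite paraproduct_norm_pos_version bmo_norm_pos_version.
by apply/seteqP; split=> b; rewrite /BMO /= bmo_norm_pos_version.
Qed.

End Transport.

(** * Weights of large characteristic along a chain of intervals *)

Section Example.
Context {R : realType} {D : set (set R)} (hD : dyadic_grid D).
Implicit Types (I K : set R) (x y : R).
Local Notation mu := (@lebesgue_measure R).
Local Notation intg I f := (mu.-integrable I (EFin \o f)).
Local Notation lchild := (lchild (D := D)).
Local Notation rchild := (rchild (D := D)).

Lemma A2const_ge1 w J : (forall x, 0 < w x) -> A2 D w -> D J -> (1 <= A2const D w)%E.
Proof.
move=> w0 wA DJ; have l0 := len_gt0 hD DJ.
have iw := A2_intg hD wA DJ; have iv := A2_intg_winv hD w0 wA DJ.
apply: (@le_trans _ _ (emean w J * emean (winv w) J)%E); last first.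
  by apply: ereal_sup_ubound; exists J.
rewrite !(emean_fin hD)// -EFinM lee_fin /mean -/(len J) mulrACA -invfM.
rewrite ler_pdivlMr ?mulr_gt0// mul1r -expr2 [leRHS]mulrC.
exact: (sqr_len_le_weights hD DJ w0 wA).
Qed.

Variables (J : set R) (DJ : D J) (N : nat).
Let a := len J.
Let a0 : 0 < a. Proof. exact: (len_gt0 hD). Qed.

(** The intervals I_0 = J, I_1, I_2, ..., each the left child of the one
    before it. *)
Definition chain k := iter k lchild J.
Arguments chain k : simpl never.

Lemma chainS k : lchild (chain k) = chain k.+1. Proof. by []. Qed.

Lemma chain_grid k : D (chain k).
Proof. by elim: k => [//|k IH]; exact: (grid_lchild hD). Qed.

Lemma len_chain k : len (chain k) = a / 2 ^+ k.
Proof.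
elim: k => [|k IH]; first by rewrite expr0 divr1.
by rewrite /chain iterS (len_lchild hD (chain_grid k)) -/(chain k) IH exprS invfM; ring.
Qed.

Lemma chain_sub j k : (j <= k)%N -> chain k `<=` chain j.
Proof.
elim: k => [|k IH]; first by rewrite leqn0 => /eqP ->.
rewrite leq_eqVlt => /predU1P[->//|]; rewrite ltnS => /IH; apply: subset_trans.
exact: (lchild_sub hD (chain_grid k)).
Qed.

Let mchain k : measurable (chain k) := measurable_grid hD (chain_grid k).

(** The value is 2^k - 1 on I_k outside I_{k+1} for k < N, and 2^N - 1 on
    I_N. *)
Definition spike x : R := \sum_(j <- iota 0 N) 2 ^+ j * \1_(chain j.+1) x.

Lemma sum_pow2 k : \sum_(j <- iota 0 k) 2 ^+ j = 2 ^+ k - 1 :> R.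
Proof.
elim: k => [|k IH]; first by rewrite big_nil expr0 subrr.
by rewrite -[in LHS]addn1 iotaD big_cat /= big_seq1 IH add0n exprS; ring.
Qed.

Lemma spike_ge k x : (k <= N)%N -> (k = 0%N \/ chain k x) -> 2 ^+ k - 1 <= spike x.
Proof.
move=> kN kx; rewrite -sum_pow2 /spike -(subnKC kN) iotaD big_cat/=.
rewrite -[leLHS]addr0 lerD//; last by apply: sumr_ge0 => j _; rewrite mulr_ge0.
rewrite big_seq [leRHS]big_seq; apply: ler_sum => j; rewrite mem_iota /= add0n => jk.
case: kx => [k0|kx]; first by rewrite k0 in jk.
by rewrite indicE mem_set ?mulr1//; exact: (chain_sub jk).
Qed.

Lemma spike_le k x : ~ chain k.+1 x -> spike x <= 2 ^+ k - 1.
Proof.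
move=> nx; rewrite -sum_pow2 /spike.
have [kN|Nk] := leqP k N.
  rewrite -(subnKC kN) iotaD big_cat/= [X in _ + X]big1_seq ?addr0; last first.
    move=> j; rewrite mem_iota add0n => /andP[_ /andP[kj _]].
    by rewrite indicE memNset ?mulr0// => jx; apply: nx; exact: (@chain_sub k.+1 j.+1).
  by apply: ler_sum => j _; rewrite ler_piMr// indicE; case: (_ \in _).
rewrite -[in leRHS](subnKC (ltnW Nk)) iotaD big_cat/= -[leLHS]addr0 lerD ?sumr_ge0//.
by apply: ler_sum => j _; rewrite ler_piMr// indicE; case: (_ \in _).
Qed.

Lemma spike_ge0 x : 0 <= spike x.
Proof. by have := @spike_ge 0 x (leq0n _) (or_introl erefl); rewrite expr0 subrr. Qed.

Lemma spike_bound x : spike x <= 2 ^+ N - 1.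
Proof. by rewrite -sum_pow2; apply: ler_sum => j _; rewrite ler_piMr// indicE; case: (_ \in _). Qed.

Definition spike_weight x : R := (1 + spike x)^-1.

Lemma spike_weight_gt0 x : 0 < spike_weight x.
Proof. by rewrite invr_gt0 ltr_pwDl// spike_ge0. Qed.

Lemma winv_spike_weight x : winv spike_weight x = 1 + spike x. Proof. by rewrite /winv invrK. Qed.

Lemma spike_weight_le k x : (k <= N)%N -> (k = 0%N \/ chain k x) -> spike_weight x <= (2 ^+ k)^-1.
Proof.
move=> kN kx; have := spike_ge kN kx; have := spike_ge0 x => b0 h.
by rewrite lef_pV2 ?posrE//; lra.
Qed.

Lemma measurable_spike : measurable_fun setT spike.
Proof.
rewrite /spike; elim: (iota 0 N) => [|j s IH].
  by under eq_fun do rewrite big_nil; exact: measurable_cst.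
under eq_fun do rewrite big_cons.
apply: measurable_funD => //; apply: measurable_funM => //; exact: measurable_indic.
Qed.

Lemma measurable_spike_weight : measurable_fun setT spike_weight.
Proof.
apply: (@measurable_winv _ (fun x => 1 + spike x)).
  by apply: measurable_funD => //; exact: measurable_spike.
by move=> x; rewrite ltr_pwDl// spike_ge0.
Qed.

Lemma intg_spike I : measurable I -> intg I spike.
Proof.
move=> mI; apply: intg_sum => // j _; apply: intgZ => //; apply: intg_indic => //.
exact: (mu_grid_lty hD (chain_grid _)).
Qed.

Lemma spike_weight_loc : locally_integrable setT spike_weight.
Proof.
apply: (@locally_integrable_bounded _ _ 1); first exact: measurable_spike_weight.
move=> x; rewrite gtr0_norm ?spike_weight_gt0//.
by have := @spike_weight_le 0 x (leq0n _) (or_introl erefl); rewrite expr0 invr1.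
Qed.

Lemma intg_spike_weight I : D I -> intg I spike_weight.
Proof. exact: (locally_integrable_intg hD spike_weight_loc). Qed.

Lemma Rintegral_spike I : measurable I ->
  \int[mu]_(x in I) spike x =
  \sum_(j <- iota 0 N) 2 ^+ j * fine (mu (chain j.+1 `&` I)).
Proof.
move=> mI; have ii j : intg I (\1_(chain j.+1)).
  by apply: intg_indic => //; exact: (mu_grid_lty hD (chain_grid _)).
rewrite Rintegral_sum//; last by move=> j _; exact: intgZ.
apply: eq_bigr => j _; rewrite RintegralZl//; congr (_ * _).
rewrite /Rintegral integral_indic //; exact: mchain.
Qed.

Lemma fine_le_len I A : D I -> measurable A -> A `<=` I -> fine (mu A) <= len I.
Proof.
move=> DI mA AI; have mI := measurable_grid hD DI.
have AIm : (mu A <= mu I)%E by apply: le_measure; rewrite ?inE.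
have Afin : mu A \is a fin_num.
  by rewrite ge0_fin_numE//; apply: le_lt_trans AIm _; exact: (mu_grid_lty hD DI).
by rewrite -lee_fin fineK// -(mu_len hD DI).
Qed.

Lemma intg_winv_spike_weight I : D I -> intg I (winv spike_weight).
Proof.
move=> DI; have mI := measurable_grid hD DI.
rewrite (_ : winv spike_weight = fun x => 1 + spike x); last by apply/funext; exact: winv_spike_weight.
by apply: intgD => //; [exact: (intg_cst hD)|exact: intg_spike].
Qed.

(** Let k be the largest index up to N with k = 0 or [I] inside I_k. On [I] the
    weight is at most 2^-k. In the mean of 1 + [spike] the terms of index
    below k contribute at most 2^k - 1; each later one contributes at most
    2^k, since an I_{j+1} that meets [I] lies in an I_{k+1} that is no longer
    than [I]. *)
Lemma spike_weight_product I : D I -> mean spike_weight I * mean (winv spike_weight) I <= N.+1%:R.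
Proof.
move=> DI; have mI := measurable_grid hD DI; have lI := len_gt0 hD DI.
pose P k := (k <= N)%N && `[< k = 0%N \/ I `<=` chain k >].
have P0 : exists k, P k by exists 0%N; apply/andP; split => //; apply/asboolP; left.
have PN k : P k -> (k <= N)%N by case/andP.
have [k /andP[kN /asboolP kI] kmax] := ex_maxnP P0 PN.
have i1 c := intg_cst hD c DI.
have m1 : mean spike_weight I <= (2 ^+ k)^-1.
  rewrite /mean ler_pdivrMr// -Rintegral_cst//; apply: le_Rintegral => //; first exact: intg_spike_weight.
  by move=> x Ix; apply: spike_weight_le => //; case: kI; [left|right; exact: b].
have m2 : mean (winv spike_weight) I <= 2 ^+ k * N.+1%:R.
  rewrite /mean -/(len I) ler_pdivrMr//; under eq_Rintegral do rewrite winv_spike_weight.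
  rewrite RintegralD//; last exact: intg_spike.
  rewrite Rintegral_cst// mul1r -/(len I) Rintegral_spike//.
  apply: (@le_trans _ _ (len I + (\sum_(j <- iota 0 k) 2 ^+ j * len I +
      \sum_(j <- iota k (N - k)) 2 ^+ k * len I))).
    rewrite lerD2l -[in leLHS](subnKC kN) iotaD add0n big_cat/=; apply: lerD.
      by apply: ler_sum => j _; rewrite ler_pM2l ?exprn_gt0//; apply: fine_le_len;
        [exact: DI|exact: measurableI|exact: subIsetr].
    rewrite big_seq [leRHS]big_seq; apply: ler_sum => j; rewrite mem_iota subnKC// => /andP[kj jN].
    have [->|/set0P[x [jx Ix]]] := eqVneq (chain j.+1 `&` I) set0.
      by rewrite measure0 mulr0 mulr_ge0// ltW.
    have nI : ~ I `<=` chain k.+1.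
      move=> h; have : P k.+1 by apply/andP; split; [exact: leq_ltn_trans kj jN|apply/asboolP; right].
      by move=> /kmax; rewrite ltnn.
    have kx : chain k.+1 x by exact: (@chain_sub k.+1 j.+1).
    have lkI : len (chain k.+1) <= len I.
      rewrite leNgt; apply/negP => h; apply: nI.
      by apply: (grid_nested hD DI (chain_grid _) Ix kx); exact: ltW.
    apply: (@le_trans _ _ (2 ^+ j * len (chain j.+1))).
      by rewrite ler_pM2l ?exprn_gt0//; apply: fine_le_len;
        [exact: chain_grid|exact: measurableI|exact: subIsetl].
    rewrite len_chain exprS; move: lkI; rewrite len_chain exprS => lkI.
    have p0 (i : nat) : (2 : R) ^+ i != 0 by rewrite expf_neq0.
    have -> : 2 ^+ j * (a / (2 * 2 ^+ j)) = 2 ^+ k * (a / (2 * 2 ^+ k)) by field; rewrite !p0.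
    by rewrite ler_pM2l// exprn_gt0.
  rewrite -mulr_suml sum_pow2 big_const_seq count_predT size_iota iter_addr_0.
  have -> : len I + ((2 ^+ k - 1) * len I + 2 ^+ k * len I *+ (N - k)) =
      2 ^+ k * (N - k).+1%:R * len I.
    by rewrite -[in RHS]addn1 natrD -[_ *+ (N - k)]mulr_natr; ring.
  by rewrite ler_pM2r// ler_pM2l ?exprn_gt0// ler_nat ltnS leq_subr.
apply: (@le_trans _ _ ((2 ^+ k)^-1 * (2 ^+ k * N.+1%:R))).
  apply: ler_pM => //; apply: divr_ge0; rewrite ?(ltW lI)//; apply: Rintegral_ge0 => x _.
    by rewrite ltW// spike_weight_gt0.
  by rewrite winv_spike_weight addr_ge0// spike_ge0.
by rewrite mulKf// expf_neq0.
Qed.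

Lemma A2const_spike_weight : (A2const D spike_weight <= N.+1%:R%:E)%E.
Proof.
apply: ge_ereal_sup => _ [I DI <-].
rewrite !(emean_fin hD)//; [|exact: intg_winv_spike_weight|exact: intg_spike_weight].
by rewrite -EFinM lee_fin spike_weight_product.
Qed.

Lemma A2_spike_weight : A2 D spike_weight.
Proof.
split; last by apply: le_lt_trans A2const_spike_weight _; rewrite ltry.
by split; [exact: spike_weight_loc|apply: aeW => x; exact: spike_weight_gt0].
Qed.

(** The right child of I_k is I_k outside I_{k+1}, where [spike] is
    constant. *)
Lemma Rintegral_spike_rchild k : (k < N)%N ->
  \int[mu]_(x in rchild (chain k)) spike x = (2 ^+ k - 1) * (a / 2 ^+ k.+1).
Proof.
move=> kN; have DC := chain_grid k.
rewrite (@Rintegral_eq_cst _ _ _ (2 ^+ k - 1)).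
- by rewrite (len_rchild hD DC) len_chain exprS; congr (_ * _); rewrite invfM; ring.
- exact: (measurable_grid hD (grid_rchild hD DC)).
move=> x Rx; apply/eqP; rewrite eq_le; apply/andP; split.
  by apply: spike_le => Lx; exact: (children_disj hD DC Lx Rx).
by apply: spike_ge; [exact: ltnW|right; exact: (rchild_sub hD DC)].
Qed.

(** By descending induction on [k], splitting I_k into I_{k+1} and the right
    child. *)
Lemma Rintegral_spike_chain k : (k <= N)%N ->
  \int[mu]_(x in chain k) spike x =
  (2 ^+ k - 1) * (a / 2 ^+ k) + (N - k)%:R * (a / 2).
Proof.
move=> /subnKC; move: (N - k)%N => d; elim: d k => [|d IH] k kd.
  rewrite addn0 in kd; rewrite mul0r addr0 (@Rintegral_eq_cst _ _ _ (2 ^+ k - 1)) ?len_chain//.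
  move=> x kx; apply/eqP; rewrite eq_le; apply/andP; split.
    by rewrite kd; exact: spike_bound.
  by apply: spike_ge; [rewrite kd|right].
have kN : (k < N)%N by rewrite -kd -addSnnS leq_addr.
have DC := chain_grid k.
rewrite (Rintegral_children hD DC); last exact: intg_spike.
rewrite chainS IH ?addSnnS// Rintegral_spike_rchild//.
have p0 : (2 : R) ^+ k != 0 by rewrite expf_neq0.
by rewrite exprS -[in RHS]addn1 natrD; field.
Qed.

(** The integrals of [spike] over the two children of I_k differ by
    (N - k) |J| / 2. *)
Lemma inner_spike k : (k < N)%N ->
  inner spike (haar (chain k)) ^+ 2 = (N - k)%:R ^+ 2 * a * 2 ^+ k / 4.
Proof.
move=> kN; have DC := chain_grid k.
rewrite (inner_haar hD DC); last exact: intg_spike.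
rewrite chainS Rintegral_spike_rchild// Rintegral_spike_chain//.
rewrite exprMn exprVn sqr_sqrtr ?(ltW (len_gt0 hD DC))// len_chain.
have -> : (N - k)%N = (N - k.+1).+1 by rewrite subnSK.
have p0 : (2 : R) ^+ k != 0 by rewrite expf_neq0.
by rewrite -[(N - k.+1).+1]addn1 natrD [2 ^+ k.+1]exprS; field; rewrite p0 gt_eqF.
Qed.

Lemma mean_spike_weight_chain k : (k < N)%N -> (2 ^+ k.+1)^-1 <= mean spike_weight (chain k).
Proof.
move=> kN; have DC := chain_grid k; have lC := len_gt0 hD DC.
have DR := grid_rchild hD DC; have mR := measurable_grid hD DR.
rewrite /mean ler_pdivlMr// (Rintegral_children hD DC); last exact: intg_spike_weight.
have Lge : 0 <= \int[mu]_(x in lchild (chain k)) spike_weight x.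
  by apply: Rintegral_ge0 => x _; rewrite ltW// spike_weight_gt0.
apply: (@le_trans _ _ (\int[mu]_(x in rchild (chain k)) spike_weight x)); last by rewrite lerDr.
apply: (@le_trans _ _ (\int[mu]_(x in rchild (chain k)) (2 ^+ k)^-1)).
  rewrite Rintegral_cst// -!/(len _) (len_rchild hD DC) exprS invfM.
  by rewrite le_eqVlt; apply/orP; left; apply/eqP; ring.
apply: le_Rintegral => //; [exact: (intg_cst hD)|exact: intg_spike_weight|].
move=> x Rx; rewrite lef_pV2 ?posrE ?exprn_gt0//; last by rewrite ltr_pwDl// spike_ge0.
have : spike x <= 2 ^+ k - 1.
  by apply: spike_le => Lx; exact: (children_disj hD DC Lx Rx).
by lra.
Qed.

Lemma spike_L2 : L2 spike_weight spike /\ energy spike_weight spike <= N%:R * (a / 2).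
Proof.
have wt0 x : 0 <= spike_weight x by rewrite ltW// spike_weight_gt0.
have bw x : spike x ^+ 2 * spike_weight x <= spike x.
  rewrite /spike_weight ler_pdivrMr ?ltr_pwDl ?spike_ge0//; have := spike_ge0 x; nra.
have mJ := measurable_grid hD DJ.
have bJ : spike = spike \_ J.
  apply/funext => x; rewrite patchE; case: ifPn => //; rewrite notin_setE => nJ.
  apply/eqP; rewrite eq_le spike_ge0 andbT.
  have := @spike_le 0 x; rewrite expr0 subrr; apply => h; apply: nJ.
  exact: (@chain_sub 0 1).
have ib : intg setT spike by rewrite bJ; apply: intg_patch => //; exact: intg_spike.
have ie : intg setT (fun x => spike x ^+ 2 * spike_weight x).
  apply: (intg_le _ _ _ ib) => //; first by apply: measurable_sqr_mul;
    [exact: measurable_spike_weight|exact: measurable_spike].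
  by move=> x _; rewrite ger0_norm ?bw// mulr_ge0// sqr_ge0.
split; first by apply/(L2P measurable_spike_weight wt0); split => //; exact: measurable_spike.
apply: (@le_trans _ _ (\int[mu]_x spike x)); first exact: le_Rintegral.
rewrite bJ -Rintegral_mkcond.
by have := @Rintegral_spike_chain 0 (leq0n _); rewrite expr0 subrr mul0r add0r subn0 => <-.
Qed.

(** For k < M, the term of I_k in the squared norm of the square function of
    [spike] is at least M^2 |J| / 8. The M terms together are compared with
    the squared norm of [spike], which is at most M |J|. This gives
    C^2 >= M^2 / 8, hence C >= M / 3. *)
Lemma square_fun_norm_spike_weight M : N = M.*2 -> (0 < M)%N ->
  ((M%:R / 3)%:E <= square_fun_norm D spike_weight)%E.
Proof.
move=> NM M0; apply: le_ereal_inf_tmp => _ [C [C0 hC] <-]; rewrite lee_fin.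
have wt0 x : 0 <= spike_weight x by rewrite ltW// spike_weight_gt0.
have [Lb Eb] := spike_L2; have [_ -> h] := hC _ Lb.
have E0 := energy_ge0 wt0 spike.
move: h; rewrite (L2norm_square_fun hD spike measurable_spike_weight wt0 intg_spike_weight).
rewrite (L2normE measurable_spike_weight wt0 Lb) -EFinM.
have -> : C * Num.sqrt (energy spike_weight spike) = Num.sqrt (C ^+ 2 * energy spike_weight spike).
  by rewrite sqrtrM ?sqr_ge0// sqrtr_sqr ger0_norm.
rewrite -[X in (_ <= X)%E]/(sqrte (C ^+ 2 * energy spike_weight spike)%:E) lee_sqrt; last first.
  by rewrite lee_fin mulr_ge0// sqr_ge0.
move=> h.
have M0' : 0 < M%:R :> R by rewrite ltr0n.
have : M%:R * (M%:R ^+ 2 * a / 8) <= C ^+ 2 * (N%:R * (a / 2)).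
  apply: (@le_trans _ _ (C ^+ 2 * energy spike_weight spike)); last by rewrite ler_wpM2l ?sqr_ge0.
  rewrite -lee_fin; apply: le_trans h; apply: esum_ge.
  exists [set` map chain (iota 0 M)].
    split; first exact: finite_seq.
    by move=> I /mapP[k _ ->]; exact: chain_grid.
  rewrite -fsbig_seq; last first.
    rewrite map_inj_in_uniq ?iota_uniq// => i j _ _ /(congr1 len).
    rewrite !len_chain => /(mulfI (lt0r_neq0 a0)) /invr_inj.
    by apply: ieexprIn => //; rewrite gt_eqF// ltr1n.
  rewrite big_map sumEFin lee_fin.
  rewrite -[X in X%:R * _](size_iota 0 M) -(count_predT (iota 0 M)) mulr_natl.
  rewrite -iter_addr_0 -big_const_seq big_seq [leRHS]big_seq.
  apply: ler_sum => k; rewrite mem_iota add0n => /andP[_ kM].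
  have kN : (k < N)%N by rewrite NM -addnn ltn_addr.
  rewrite inner_spike//.
  apply: (@le_trans _ _ ((2 ^+ k.+1)^-1 * ((N - k)%:R ^+ 2 * a * 2 ^+ k / 4))); last first.
    by rewrite ler_wpM2r ?mean_spike_weight_chain// divr_ge0// !mulr_ge0 ?sqr_ge0 ?exprn_ge0// ltW.
  have p0 : (2 : R) ^+ k != 0 by rewrite expf_neq0.
  have -> : (2 ^+ k.+1)^-1 * ((N - k)%:R ^+ 2 * a * 2 ^+ k / 4) = (N - k)%:R ^+ 2 * a / 8.
    by rewrite exprS; field.
  rewrite ler_pM2r ?invr_gt0// ler_pM2r// lerXn2r ?nnegrE// ler_nat.
  by rewrite NM -addnn leq_subRL ?(leq_trans (ltnW kM)) ?leq_addr// leq_add2r ltnW.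
rewrite NM -muln2 natrM.
have -> : C ^+ 2 * (M%:R * 2 * (a / 2)) = M%:R * a * C ^+ 2 by field.
have -> : M%:R * (M%:R ^+ 2 * a / 8) = M%:R * a * (M%:R ^+ 2 / 8) by field.
rewrite ler_pM2l ?mulr_gt0// => h8.
rewrite -(@ler_pXn2r _ 2)// ?nnegrE ?divr_ge0//.
apply: le_trans h8; rewrite exprMn ler_pM2l ?exprn_gt0//.
by rewrite -subr_ge0; lra.
Qed.

End Example.

(** * Sharpness of the quadratic dependence *)

Section Sharpness.
Context {R : realType} {D : set (set R)} (hD : dyadic_grid D).

(** The exponent may be raised to a nonnegative one because the A_2
    characteristic is at least 1. The weights with N = 2 M have characteristic
    at most 2 M + 1 <= 3 M, so y = 3 M satisfies y^2 <= c |C| y^beta with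
    beta < 2 for every M. *)
Lemma no_smaller_exponent : ~ (exists alpha C : R, alpha < 2 /\
       forall w b : R -> R, A2 D w -> BMO D w b ->
         (paraproduct_norm D w b <=
          C%:E * bmo_norm D w b * A2const D w `^ alpha)%E).
Proof.
move=> [alpha [C [al2 h]]].
have [J [DJ _ _]] := grid_cover hD 0 0.
pose be := Num.max alpha 0.
have be0 : 0 <= be by rewrite le_max lexx orbT.
have be2 : be < 2 by rewrite gt_max al2/=.
have [c c0 cE] : exists2 c : R, 0 < c &
    forall z : R, 6^-1 * (z / 3) ^+ 2 = c^-1 * (3 * z) ^+ 2.
  exists (6 * 9 ^+ 2); first by rewrite mulr_gt0// exprn_gt0.
  by move=> z; field.
have key M : (0 < M)%N -> (3 * M%:R) ^+ 2 <= c * `|C| * (3 * M%:R) `^ be.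
  move=> M0; pose w := spike_weight (D := D) J M.*2.
  have w0 x : 0 < w x by exact: spike_weight_gt0.
  have wA : A2 D w := A2_spike_weight hD DJ M.*2.
  have A1 : (1 <= A2const D w)%E := A2const_ge1 hD w0 wA DJ.
  have AM := A2const_spike_weight hD DJ M.*2.
  have [r rE] : exists r, A2const D w = r%:E.
    exists (fine (A2const D w)); rewrite fineK// ge0_fin_numE; first exact: wA.2.
    exact: le_trans A1.
  rewrite -/w rE !lee_fin in A1 AM.
  have rM : r <= 3 * M%:R.
    by apply: le_trans AM _; rewrite -natrM ler_nat -addnn -addn1 !mulSn mul0n addn0 addnA leq_add2l.
  have S0 : 0 <= M%:R / 3 :> R by rewrite divr_ge0.
  have : ((6^-1 * (M%:R / 3) ^+ 2)%:E <= (C * r `^ alpha)%:E)%E.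
    apply: (@le_trans _ _ (6^-1%:E * square_fun_norm D w ^+ 2)%E).
      rewrite EFinM EFin_expe lee_pmul2l//; apply: lee_pmul; rewrite ?lee_fin//;
        exact: (square_fun_norm_spike_weight hD DJ erefl M0).
    apply: (le_trans (lower_bound hD wA)); apply: ge_ereal_sup => _ [b [Bb b0] <-].
    have bge : (0 <= bmo_norm D w b)%E.
      have ib := locally_integrable_intg hD Bb.1 DJ.
      apply: le_trans (bmo_norm_ge hD w0 wA DJ ib).
      rewrite lee_fin divr_ge0//; last by rewrite ltW// (A2_gt0 hD w0 wA DJ).
      exact: Rintegral_ge0.
    have [t tE] : exists t, bmo_norm D w b = t%:E.
      by exists (fine (bmo_norm D w b)); rewrite fineK// ge0_fin_numE//; exact: Bb.2.
    have := h w b wA Bb; move: bge b0; rewrite tE rE lee_fin eqe => t0 tn0 ht.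
    have tgt : 0 < t by rewrite lt_neqAle eq_sym tn0.
    rewrite inver gt_eqF// lee_pdivrMr//; apply: le_trans ht _.
    by rewrite poweR_EFin -!EFinM lee_fin mulrAC.
  rewrite lee_fin => le1.
  have r0 : 0 < r by lra.
  have le2 : C * r `^ alpha <= `|C| * (3 * M%:R) `^ be.
    apply: (@le_trans _ _ (`|C| * r `^ alpha)).
      by rewrite ler_wpM2r ?powR_ge0// ler_norm.
    rewrite ler_wpM2l//; apply: (@le_trans _ _ (r `^ be)).
      by rewrite ler_powR// le_max lexx.
    have M3 : 0 <= 3 * M%:R :> R by rewrite mulr_ge0.
    by apply: ge0_ler_powR; rewrite ?nnegrE; [exact: be0|exact: ltW|exact: M3|exact: rM].
  by rewrite -mulrA -ler_pdivrMl// -cE; exact: le_trans le1 le2.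
pose g := 2 - be; have g0 : 0 < g by rewrite subr_gt0.
pose X := (c * `|C| + 1) `^ (g^-1).
have cC0 : 0 < c * `|C| + 1 by rewrite ltr_wpDl// mulr_ge0// ltW.
have [y [y0 Xy ky]] : exists y : R,
    [/\ 0 < y, X <= y & y ^+ 2 <= c * `|C| * y `^ be].
  have h1 := archi_boundP (powR_ge0 (c * `|C| + 1) (g^-1)).
  move: (Num.bound _) h1 => n h1.
  exists (3 * n.+1%:R); split; [by rewrite mulr_gt0| |exact: key].
  have h2 : n%:R <= n.+1%:R :> R by rewrite ler_nat.
  have h3 : 0 <= n.+1%:R :> R by [].
  by rewrite /X; lra.
have yE : y ^+ 2 = y `^ g * y `^ be.
  rewrite -powRD; last by rewrite (gt_eqF y0) implybT.
  by rewrite /g subrK -powR_mulrn// ltW.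
move: ky; rewrite yE ler_pM2r ?powR_gt0//.
have : X `^ g <= y `^ g.
  by apply: ge0_ler_powR; rewrite ?nnegrE ?powR_ge0// ltW.
rewrite /X -powRrM mulVf ?(gt_eqF g0)// powRr1 ?(ltW cC0)//; lra.
Qed.

End Sharpness.

Theorem mainTheorem13 (R : realType) (D : set (set R)) (hD : dyadic_grid D) :
  (forall w : R -> R, A2 D w ->
     (6^-1%:E * square_fun_norm D w ^+ 2 <=
      ereal_sup [set paraproduct_norm D w b / bmo_norm D w b
                | b in [set b | BMO D w b /\ bmo_norm D w b != 0]])%E) /\
  ~ (exists alpha C : R, alpha < 2 /\
       forall w b : R -> R, A2 D w -> BMO D w b ->
         (paraproduct_norm D w b <=
          C%:E * bmo_norm D w b * A2const D w `^ alpha)%E).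
Proof.
split; first by move=> w wA; exact: (lower_bound hD wA).
exact: no_smaller_exponent.
Qed.
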